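(* For $n\ge 1$ and $t\ge 0$ let $m_n(t)\ge 0$ be the magnetisation, defined by $m_n^2(t)=\frac{1}{Z_n(t)}\mathbb{E}\big(\big(\sum_{k=1}^n k^2\alpha_k(\pi(t))\big)2^{\alpha(\pi(t))}\big)$ with $Z_n(t)=\mathbb{E}(2^{\alpha(\pi(t))})$, where $(\pi(t))_{t\ge0}$ is the continuous-time interchange process on the complete graph on $n$ vertices. Then: (i) for every fixed real $\tau$ with $0\le\tau<2$ there is a constant $C=C(\tau)>0$ such that $m_n(\tau/n)\le C\sqrt{n}$ for all $n\ge1$; (ii) for every fixed real $\tau>2$ there is a constant $c=c(\tau)>0$ such that $m_n(\tau/n)\ge c\,n$ for all $n\ge 1$.
   Context: The interchange process on the complete graph on $\{1,\dots,n\}$ is the continuous-time random walk $(\pi(t))_{t\ge0}$ on the symmetric group $\mathrm{Sym}_n$ started at the identity: each unordered pair $\{i,j\}$, $i\ne j$, carries an independent Poisson clock of rate $1$, and when the clock of $\{i,j\}$ rings the current permutation $\pi$ is replaced by $(ij)\pi$. For a permutation $\pi$, $\alpha_k(\pi)$ is the number of cycles of length $k$ in $\pi$ (fixed points are cycles of length 1), and $\alpha(\pi)=\sum_k\alpha_k(\pi)$ is the total number of cycles. *)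

(* Defs.v *)
From HB Require Import structures.
From mathcomp Require Import all_boot all_order all_algebra all_fingroup.
From mathcomp Require Import all_classical all_reals all_analysis.

Set Implicit Arguments.
Unset Strict Implicit.
Unset Printing Implicit Defensive.

Import Order.TTheory GRing.Theory Num.Theory.
Import numFieldNormedType.Exports.

Local Open Scope classical_set_scope.
Local Open Scope ring_scope.

Section independence.
Context d (T : measurableType d) (R : realType) (P : probability T R).

Definition mutually_independent (I : finType) (G : I -> set (set T)) : Prop :=
  forall (J : {set I}) (A : I -> set T),
    (forall i, i \in J -> G i (A i)) ->
    P (\bigcap_(i in [set` J]) A i) = (\prod_(i in J) P (A i))%E.

(* The sigma-algebra generated by the whole process (X t)_{t >= 0}. *)
Definition sigma_process (X : R -> {RV P >-> nat}) : set (set T) :=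
  <<s \bigcup_(t in [set t : R | 0 <= t]) g_sigma_algebra_preimage (X t) >>.

End independence.

Section poisson_process.
Context d (T : measurableType d) (R : realType) (P : probability T R).

(* Processes are indexed by all of R, but only the times t >= 0 are ever
   constrained or used. *)
Record poisson_process (rate : R) (N : R -> {RV P >-> nat}) : Prop := {
  poisson_start : forall w, N 0 w = 0%N;
  poisson_nondecreasing : forall w (s t : R),
    0 <= s -> s <= t -> (N s w <= N t w)%N;
  poisson_right_continuous : forall w (t : R),
    0 <= t -> \forall s \near t^'+, N s w = N t w;
  (* The natural number argument of [poisson_prob] is a dummy. *)
  poisson_increment : forall (s t : R) (A : set nat), 0 <= s -> s <= t ->
    P ((fun w => (N t w - N s w)%N) @^-1` A)
    = poisson_prob (rate * (t - s)) 0%N A;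
  poisson_independent_increments : forall (m : nat) (t : nat -> R),
    0 <= t 0%N -> (forall i, t i <= t i.+1) ->
    mutually_independent P (fun i : 'I_m =>
      g_sigma_algebra_preimage (fun w => (N (t i.+1) w - N (t i) w)%N))
}.

(* A clock with counting path N rings at the jump times of N. *)
Definition rings (N : R -> nat) (t : R) : Prop :=
  0 < t /\ forall s, 0 <= s -> s < t -> (N s < N t)%N.

End poisson_process.

(* The unordered pair {i, j} is represented by (i, j) with i < j. *)
Definition edge (n : nat) := {e : 'I_n * 'I_n | (e.1 < e.2)%N}.

Definition transposition (n : nat) (e : edge n) : 'S_n :=
  tperm (val e).1 (val e).2.

(* In MathComp (s * u) x = u (s x), so the composition (i j) o pi of functions
   is written pi * tperm i j.  Almost surely no two clocks ring simultaneously,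
   which is why the dynamics are only required for almost every w. *)
Record interchange_process (n : nat) d (T : measurableType d) (R : realType)
    (P : probability T R) (N : edge n -> R -> {RV P >-> nat})
    (pi : R -> T -> 'S_n) : Prop := {
  clocks_poisson : forall e, poisson_process 1 (N e);
  clocks_independent :
    mutually_independent P (fun e => sigma_process (N e));
  interchange_measurable : forall (t : R) (s : 'S_n),
    0 <= t -> measurable (pi t @^-1` [set s]);
  interchange_start : {ae P, forall w, pi 0 w = 1%g};
  interchange_constant : {ae P, forall w, forall s t : R,
    0 <= s -> s <= t ->
    (forall e u, s < u -> u <= t -> ~ rings (fun v => N e v w) u) ->
    pi t w = pi s w};
  interchange_jump : {ae P, forall w, forall (e : edge n) (t : R),
    rings (fun v => N e v w) t ->
    \forall u \near t^'-, pi t w = (pi u w * transposition e)%g}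
}.

Definition cycles_of_length (n : nat) (k : nat) (s : 'S_n) : nat :=
  #|[set c in porbits s | #|c| == k]%SET|.

Definition num_cycles (n : nat) (s : 'S_n) : nat :=
  (\sum_(1 <= k < n.+1) cycles_of_length k s)%N.

Section magnetisation.
Context (n : nat) d (T : measurableType d) (R : realType).
Context (P : probability T R) (pi : R -> T -> 'S_n).

Definition partition_function (t : R) : R :=
  fine 'E_P[(fun w => 2 ^+ num_cycles (pi t w))%R]%E.

Definition magnetisation (t : R) : R :=
  Num.sqrt ((partition_function t)^-1 *
    fine 'E_P[(fun w =>
      (\sum_(1 <= k < n.+1) k ^ 2 * cycles_of_length k (pi t w))%N%:R
      * 2 ^+ num_cycles (pi t w))%R]%E).

End magnetisation.

(* Main.v *)
Require Import Defs.
From HB Require Import structures.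
From mathcomp Require Import all_boot all_order all_algebra all_fingroup.
From mathcomp Require Import all_classical all_reals all_analysis.
From mathcomp Require Import measurable_realfun ring lra zify.

Set Implicit Arguments.
Unset Strict Implicit.
Unset Printing Implicit Defensive.

Import Order.TTheory GRing.Theory Num.Theory.
Import numFieldNormedType.Exports.

(* Let f_k(s) be the number of k-subsets B with s B = B. Each character
   x_k = f_k - f_(k-1) is an eigenfunction of the generator, with eigenvalue
   - k (n + 1 - k): both f_k and f_(k-1) are compared with the count of pairs
   of a (k-1)-subset D and a k-subset E such that D and s D are contained in E.
   Hence E x_k(pi(t)) = exp(- k (n + 1 - k) t) x_k(1). On the other hand,
   splitting a set of spins invariant under s into cycles gives
     2 ^ alpha = sum_k f_k   and
     (sum_k k^2 alpha_k) 2 ^ alpha = sum_k (n - 2 k)^2 f_k.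
   Summation by parts then yields, with N = n + 1 and S a sum of N independent
   signs,
     3 m_n(t)^2 + 1 = E[S^4 exp(t S^2 / 4)] / E[S^2 exp(t S^2 / 4)],
   which is the Curie-Weiss model at inverse temperature N t / 2.
   For N t < 2 the ratio is O(N) by the integration by parts
     E[S (psi(S + 1) + psi(S - 1))] = N E[psi(S + 1) - psi(S - 1)]
   applied to psi(x) = (x^3 - x) exp(t x^2 / 4). For N t > 2 it is at least a
   multiple of N^2 by Jensen's inequality and the bound
     E[S^2 exp(t S^2 / 4)] >= N cosh(h)^N exp(- h^2 / t). *)

(** * Eigenfunctions of the generator *)

Lemma sum_nat_constT (T : finType) (c : nat) : (\sum_(i : T) c = #|T| * c)%N.
Proof. by rewrite -sum_nat_const; apply: eq_bigl. Qed.

(** * One-point changes and transpositions of finite sets *)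

Section finite_sets.
Context (T : finType).
Implicit Types (A B C X Y : {set T}).

Lemma sum_eq_set1 X Y : X \subset Y ->
  (\sum_(i in Y) (X == [set i]%SET) = (#|X| == 1))%N.
Proof.
move=> XY; have [/cards1P[x Xx]|X1] := boolP (#|X| == 1%N).
  have xY : x \in Y by rewrite -finset.sub1set -Xx.
  rewrite (bigD1 x)//= Xx eqxx big1 ?addn0// => i /andP[_ ix].
  by case: eqP => // /finset.set1_inj xi; rewrite xi eqxx in ix.
rewrite big1// => i _; case: eqP => // Xi.
by rewrite Xi cards1 in X1.
Qed.

Lemma setD_eq0_card A B : #|A| = #|B| -> (A :\: B == finset.set0) = (A == B).
Proof.
move=> AB; rewrite finset.setD_eq0; apply/idP/eqP => [sAB|->//].
by apply/eqP; rewrite eqEcard sAB AB leqnn.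
Qed.

Lemma cardsDC A B : #|A| = #|B| -> #|A :\: B| = #|B :\: A|.
Proof. by move=> AB; rewrite !cardsD AB finset.setIC. Qed.

(** When B and C differ, only the removal of the single element of [C :\: B] can push C into B; when
    they agree, every removal does. *)
Lemma sum_subset_setD1 B C : #|B| = #|C| ->
  (\sum_(i in C) (C :\ i \subset B) = #|B| * (B == C) + (#|C :\: B| == 1))%N.
Proof.
move=> BC; have [<-|neqBC] := eqVneq B C.
  rewrite finset.setDv cards0 muln1 addn0 -sum1_card.
  by apply: eq_bigr => i _; rewrite subD1set.
rewrite muln0 add0n -(sum_eq_set1 (subsetDl C B)); apply: eq_bigr => i iC.
congr nat_of_bool; rewrite finset.subDset finset.setUC -finset.subDset subset1.
by rewrite setD_eq0_card// (eq_sym C) (negPf neqBC) orbF.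
Qed.

Lemma sum_subset_setU1 B C : #|B| = #|C| ->
  (\sum_(i in ~: B) (C \subset i |: B) = (#|T| - #|B|) * (B == C) + (#|C :\: B| == 1))%N.
Proof.
move=> BC; have [<-|neqBC] := eqVneq B C.
  rewrite finset.setDv cards0 muln1 addn0 -(cardsC B) addKn -sum1_card.
  by apply: eq_bigr => i _; rewrite finset.subsetUr.
have CB : C :\: B \subset ~: B by apply/fintype.subsetP => x; rewrite !inE => /andP[].
rewrite muln0 add0n -(sum_eq_set1 CB); apply: eq_bigr => i iC.
congr nat_of_bool; rewrite finset.setUC -finset.subDset subset1.
by rewrite setD_eq0_card// (eq_sym C) (negPf neqBC) orbF.
Qed.

Lemma imset_tperm_id (i j : T) B : (i \in B) = (j \in B) -> tperm i j @: B = B.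
Proof.
move=> ij; apply/eqP; rewrite eqEcard card_imset ?leqnn ?andbT; last exact: perm_inj.
apply/fintype.subsetP => _ /imsetP[x xB ->].
by case: tpermP => [xi|xj|//]; [rewrite -ij -xi | rewrite ij -xj].
Qed.

Lemma imset_tperm_swap (i j : T) B : i \in B -> j \notin B ->
  tperm i j @: B = j |: (B :\ i).
Proof.
move=> iB jB; apply/eqP; rewrite eqEcard; apply/andP; split.
  apply/fintype.subsetP => _ /imsetP[x xB ->]; rewrite !inE.
  case: tpermP => [_|xj|/eqP -> _]; first by rewrite eqxx.
    by rewrite -xj xB in jB.
  by rewrite xB orbT.
rewrite cardsU1 !inE (negPf jB) andbF card_imset; last exact: perm_inj.
by rewrite [#|B|](cardsD1 i) iB leqnn.
Qed.

Lemma setU1D1_eq (i j : T) B C : #|B| = #|C| -> i \in B -> j \notin B ->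
  (j |: (B :\ i) == C) = (B :\: C == [set i]%SET) && (C :\: B == [set j]%SET).
Proof.
move=> BC iB jB; have ij : i != j by apply: contraNneq jB => <-.
apply/eqP/andP => [<-|[/eqP Bi /eqP Cj]].
  split; apply/eqP/finset.setP => x; rewrite !inE.
    by case: (eqVneq x i) => [->|xi]/=; [rewrite (negPf ij) iB| case: (x \in B); rewrite ?orbT ?andbF].
  by case: (eqVneq x j) => [->|xj]/=; [rewrite jB | case: (x \in B); rewrite ?andbF].
apply/finset.setP => x; rewrite !inE.
have /finset.setP/(_ x) := Bi; have /finset.setP/(_ x) := Cj; rewrite !inE.
by case: (x == i) (x == j) (x \in B) (x \in C) => [] [] [] [].
Qed.

(** A swap of i in B with j outside B gives C exactly when [B :\: C] is {i} and [C :\: B] is {j}, so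
    at most one pair counts. *)
Lemma sum_tperm_swap B C : #|B| = #|C| ->
  (\sum_(i in B) \sum_(j in ~: B) (tperm i j @: B == C) = (#|C :\: B| == 1))%N.
Proof.
move=> BC; transitivity (\sum_(i in B) (B :\: C == [set i]%SET) *
    \sum_(j in ~: B) (C :\: B == [set j]%SET))%N.
  apply: eq_bigr => i iB; rewrite big_distrr/=; apply: eq_bigr => j.
  rewrite inE => jB; rewrite imset_tperm_swap// setU1D1_eq//.
  by do 2!case: (_ == _).
rewrite -big_distrl/= sum_eq_set1 ?subsetDl// sum_eq_set1; last first.
  by apply/fintype.subsetP => x; rewrite !inE => /andP[].
by rewrite -(cardsDC BC); case: (_ == _).
Qed.

(** Ordered pairs inside B or inside its complement fix B; the mixed pairs are counted once in each
    order, whence the factor 2. *)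
Lemma sum_tperm_all B C : #|B| = #|C| ->
  (\sum_i \sum_j (tperm i j @: B == C) =
   (#|B| ^ 2 + #|~: B| ^ 2) * (B == C) + 2 * (#|C :\: B| == 1))%N.
Proof.
move=> BC; have split F : (\sum_(i : T) F i = \sum_(i in B) F i + \sum_(i in ~: B) F i)%N.
  rewrite (bigID (mem B))/=; congr (_ + _)%N.
  by apply: eq_bigl => i; rewrite !inE.
have const (A A' : {set T}) : (forall i j, i \in A -> j \in A' -> (i \in B) = (j \in B)) ->
    (\sum_(i in A) \sum_(j in A') (tperm i j @: B == C) = #|A| * #|A'| * (B == C))%N.
  move=> AA'; transitivity (\sum_(i in A) \sum_(j in A') (B == C))%N.
    apply: eq_bigr => i iA; apply: eq_bigr => j jA; rewrite imset_tperm_id//; exact: AA'.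
  by rewrite !sum_nat_const mulnA.
rewrite split; under eq_bigr do rewrite split; rewrite big_split/=.
under [X in (_ + X)%N]eq_bigr do rewrite split; rewrite [X in (_ + X)%N]big_split/=.
rewrite const; last by move=> i j -> ->.
rewrite (const (~: B) (~: B)); last by move=> i j; rewrite !inE => /negPf -> /negPf ->.
rewrite sum_tperm_swap// [X in (_ + (X + _))%N]exchange_big/=.
under [X in (_ + (X + _))%N]eq_bigr do under eq_bigr do rewrite tpermC.
by rewrite sum_tperm_swap// -!mulnn; lia.
Qed.

End finite_sets.

Section edges.
Context (n : nat).

Lemma sum_edge (F : 'I_n -> 'I_n -> nat) : (forall i j, F i j = F j i) ->
  (\sum_i \sum_j F i j =
   2 * \sum_(e : edge n) F (val e).1 (val e).2 + \sum_i F i i)%N.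
Proof.
move=> FC.
have -> : (\sum_(e : edge n) F (val e).1 (val e).2 =
    \sum_(p : 'I_n * 'I_n | p.1 < p.2) F p.1 p.2)%N.
  by rewrite -(big_sub [pred p : 'I_n * 'I_n | p.1 < p.2]%N (fun p => F p.1 p.2)).
rewrite pair_big/= (bigID (fun p : 'I_n * 'I_n => p.1 < p.2)%N)/= mul2n -addnn -addnA.
congr (_ + _)%N; rewrite (bigID (fun p : 'I_n * 'I_n => p.2 < p.1)%N)/=.
congr (_ + _)%N.
  rewrite (reindex_inj (h := fun p : 'I_n * 'I_n => (p.2, p.1)))/=; last first.
    by move=> [a b] [c d] /= [-> ->].
  by apply: eq_big => [p|p _]; [case: ltngtP | exact: FC].
rewrite -(pair_big_dep xpredT (fun i j : 'I_n => ~~ (i < j) && ~~ (j < i))%N F)/=.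
apply: eq_bigr => i _; rewrite (big_pred1 i)// => j.
by rewrite -!leqNgt -eqn_leq eq_sym.
Qed.

Lemma card_edge : (2 * #|{: edge n}| + n = n ^ 2)%N.
Proof.
have := @sum_edge (fun _ _ => 1%N) (fun _ _ => erefl).
by rewrite !sum_nat_constT !card_ord !muln1 -mulnn => ->.
Qed.

(** For C = B this says that exactly |B| (n - |B|) edges move B. That number stands on the left so
    that it is never subtracted from the edge count in [nat]. *)
Lemma sum_edge_imset (B C : {set 'I_n}) : #|B| = #|C| ->
  (\sum_(e : edge n) (transposition e @: B == C) + #|B| * (n - #|B|) * (B == C) =
   #|{: edge n}| * (B == C) + (#|C :\: B| == 1))%N.
Proof.
move=> BC; have := @sum_edge (fun i j => (tperm i j @: B == C) : nat).
rewrite sum_tperm_all// => /(_ (fun i j => congr1 _ _)) E.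
have {E} : ((#|B| ^ 2 + #|~: B| ^ 2) * (B == C) + 2 * (#|C :\: B| == 1) =
    2 * \sum_(e : edge n) (transposition e @: B == C) + n * (B == C))%N.
  rewrite E; last by move=> i j; rewrite tpermC.
  congr (_ + _)%N; 
  transitivity (\sum_(i < n) (B == C))%N; last by rewrite sum_nat_constT card_ord.
  by apply: eq_bigr => i _; rewrite imset_tperm_id.
have := card_edge; have := cardsC B; rewrite card_ord.
set b := #|B|; set c := #|~: B|; set M := #|_| => bc; rewrite -!mulnn => Mn.
have -> : (n - b = c)%N by rewrite -bc addKn.
have nn : (n * n = b * b + c * c + 2 * (b * c))%N by rewrite -bc; nia.
case: (B == C); rewrite ?muln1 ?muln0; nia.
Qed.

End edges.

(** * Invariant k-subsets and the generator *)

Section invariant_sets.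
Context (T : finType).
Implicit Types (s : {perm T}) (B : {set T}) (k : nat).

(** The permutation character on k-subsets, f_k in the notation above. *)
Definition invariant_sets k s :=
  #|[set B : {set T} | (#|B| == k) && (s @: B == B)]%SET|.

(** For such B exactly one transposition maps s B back to B; these sets are what keeps f_k itself
    from being an eigenfunction. *)
Definition near_invariant_sets k s :=
  #|[set B : {set T} | (#|B| == k) && (#|s @: B :\: B| == 1%N)]%SET|.

Lemma sum_pred_card k (P : pred {set T}) :
  (\sum_(B : {set T} | #|B| == k) P B = #|[set B : {set T} | (#|B| == k) && P B]%SET|)%N.
Proof.
rewrite -sum1_card [RHS](eq_bigl (fun B => (#|B| == k) && P B)); last by move=> B; rewrite inE.
by rewrite -big_mkcondr.
Qed.

Lemma sum_set_cardS k (F : {set T} -> T -> nat) :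
  (\sum_(B : {set T} | #|B| == k.+1) \sum_(i in B) F B i =
   \sum_(B : {set T} | #|B| == k) \sum_(i in ~: B) F (i |: B) i)%N.
Proof.
rewrite !pair_big_dep/=.
rewrite (reindex_onto (fun p : {set T} * T => (p.2 |: p.1, p.2))
  (fun p => (p.1 :\ p.2, p.2)))/=; last first.
  by move=> [B i] /= /andP[_ iB]; rewrite finset.setD1K.
apply: eq_bigl => -[B i] /=; rewrite !inE/= eqxx xpair_eqE eqxx andbT cardsU1.
have [iB|iB] := boolP (i \in B); last by rewrite finset.setU1K// eqxx !andbT.
rewrite !andbF; apply/negbTE/negP => /andP[_ /eqP/finset.setP/(_ i)].
by rewrite !inE eqxx iB.
Qed.

(** Double count of the pairs D in E with |D| = k, |E| = k + 1 and s D in E: the left side fixes E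
    and removes a point, the right side fixes D and adds one. *)
Lemma invariant_setsS k s :
  (k.+1 * invariant_sets k.+1 s + near_invariant_sets k.+1 s =
   (#|T| - k) * invariant_sets k s + near_invariant_sets k s)%N.
Proof.
have cs B : #|s @: B| = #|B| by rewrite card_imset//; exact: perm_inj.
transitivity (\sum_(B : {set T} | #|B| == k.+1) \sum_(i in B) (s @: (B :\ i) \subset B))%N.
  rewrite /invariant_sets /near_invariant_sets -!sum_pred_card big_distrr -big_split/=.
  apply: eq_bigr => B /eqP Bk.
  rewrite -Bk eq_sym -(sum_subset_setD1 (esym (cs B))).
  rewrite big_imset/=; last by move=> ? ? _ _; exact: perm_inj.
  apply: eq_bigr => i iB; suff -> : s @: B :\ s i = s @: (B :\ i) by [].
  apply/finset.setP => x; rewrite !inE; apply/andP/imsetP => [[xi /imsetP[y yB xy]]|[y]].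
    by exists y => //; rewrite !inE yB andbT; apply: contraNneq xi => <-; rewrite xy.
  rewrite !inE => /andP[yi yB] ->; split; last exact: imset_f.
  by rewrite (inj_eq perm_inj).
rewrite sum_set_cardS /invariant_sets /near_invariant_sets -!sum_pred_card big_distrr -big_split/=.
apply: eq_bigr => B /eqP Bk; rewrite -Bk eq_sym -(sum_subset_setU1 (esym (cs B))).
apply: eq_bigr => i; rewrite inE => iB.
by rewrite finset.setU1K.
Qed.

End invariant_sets.

(** A transposition is an involution, so its product with s fixes B exactly when the transposition
    alone maps B to s B; [sum_edge_imset] then applies with C = s B. *)
Lemma sum_edge_invariant_sets n k (s : 'S_n) :
  (\sum_(e : edge n) invariant_sets k (s * transposition e)%g
     + k * (n - k) * invariant_sets k s =
   #|{: edge n}| * invariant_sets k s + near_invariant_sets k s)%N.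
Proof.
have cs (B : {set 'I_n}) : #|s @: B| = #|B| by rewrite card_imset//; exact: perm_inj.
transitivity (\sum_(B : {set 'I_n} | #|B| == k)
   (\sum_(e : edge n) (transposition e @: B == s @: B) + #|B| * (n - #|B|) * (B == s @: B)))%N.
  rewrite big_split/= exchange_big/=; congr (_ + _)%N.
    apply: eq_bigr => e _; rewrite /invariant_sets -sum_pred_card.
    apply: eq_bigr => B _; congr nat_of_bool.
    have inv (A : {set 'I_n}) : transposition e @: (transposition e @: A) = A.
      rewrite -imset_comp -[RHS]imset_id; apply: eq_imset => x /=.
      by rewrite /transposition tpermK.
    rewrite (_ : (s * transposition e)%g @: B = transposition e @: (s @: B)); last first.
      by rewrite -imset_comp; apply: eq_imset => x /=; rewrite permM.
    by apply/eqP/eqP => H; [rewrite -[in LHS]H inv | rewrite -H inv].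
  rewrite /invariant_sets -sum_pred_card big_distrr/=.
  by apply: eq_bigr => B /eqP ->; rewrite (eq_sym B).
rewrite /near_invariant_sets /invariant_sets -!sum_pred_card big_distrr -big_split/=.
by apply: eq_bigr => B _; rewrite sum_edge_imset ?cs// (eq_sym B).
Qed.

Section specht.
Context (R : comPzRingType) (n : nat).
Local Open Scope ring_scope.

(* The character of the Specht module of shape (n - k, k) when k <= n / 2; it is
   antisymmetric under k -> n + 1 - k. *)
Definition two_row_character k (s : 'S_n) : R :=
  (invariant_sets k s)%:R - (if k is k'.+1 then (invariant_sets k' s)%:R else 0).

Lemma invariant_sets_gt k (s : 'S_n) : (n < k)%N -> invariant_sets k s = 0%N.
Proof.
move=> nk; apply: eq_card0 => B; rewrite !inE; apply/negbTE/nandP; left.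
by rewrite neq_ltn (leq_ltn_trans (max_card _))// card_ord.
Qed.

Lemma invariant_sets0 (s : 'S_n) : invariant_sets 0 s = 1%N.
Proof.
rewrite /invariant_sets (_ : [set B | _]%SET = [set finset.set0]%SET) ?cards1//.
apply/finset.setP => B; rewrite !inE cards_eq0.
by case: eqVneq => //= ->; rewrite imset0 eqxx.
Qed.

Lemma invariant_sets1 k : invariant_sets k (1%g : 'S_n) = 'C(n, k).
Proof.
rewrite -[in RHS](card_ord n) -cardsT -cards_draws; congr #|pred_of_set _|.
apply/finset.setP => B; rewrite !inE finset.subsetT andTb.
rewrite [X in _ && X](_ : _ = true) ?andbT//; apply/eqP.
by rewrite -[RHS]imset_id; apply: eq_imset => x; rewrite perm1.
Qed.

(** By [invariant_setsS] the near-invariant counts at k and k - 1 differ by multiples of f_k and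
    f_(k-1), so they drop out of the difference. *)
Lemma sum_edge_two_row_character k (s : 'S_n) : (k <= n.+1)%N ->
  \sum_(e : edge n) two_row_character k (s * transposition e)%g =
  (#|{: edge n}|%:R - k%:R * (n.+1%:R - k%:R)) * two_row_character k s.
Proof.
have Lk j : (j <= n)%N -> \sum_(e : edge n) (invariant_sets j (s * transposition e)%g)%:R =
    (#|{: edge n}|%:R - j%:R * (n%:R - j%:R)) * (invariant_sets j s)%:R
     + (near_invariant_sets j s)%:R :> R.
  move=> jn; rewrite -natr_sum; have := sum_edge_invariant_sets j s.
  move=> /(congr1 (fun m => m%:R : R)); rewrite !natrD !natrM natrB// => E.
  by apply: (addIr (j%:R * (n%:R - j%:R) * (invariant_sets j s)%:R)); rewrite E; ring.
case: k => [|k] kn; rewrite /two_row_character sumrB/=.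
  under eq_bigr do rewrite invariant_sets0.
  by rewrite sumr_const sumr_const invariant_sets0 !mul0rn !subr0 mul0r subr0 mulr1.
have := invariant_setsS k s; rewrite card_ord => /(congr1 (fun m => m%:R : R)).
rewrite ltnS in kn; rewrite !natrD !natrM natrB// => E.
rewrite [X in _ - X]Lk//.
have {}E : (near_invariant_sets k s)%:R = k.+1%:R * (invariant_sets k.+1 s)%:R +
    (near_invariant_sets k.+1 s)%:R - (n%:R - k%:R) * (invariant_sets k s)%:R :> R.
  by apply: (addrI ((n%:R - k%:R) * (invariant_sets k s)%:R)); rewrite -E -natr1; ring.
have [kn'|kn'] := ltnP k n.
  by rewrite Lk// E -!natr1; ring.
(* The index n + 1 is out of reach of [Lk], but no set has n + 1 elements: only f_n remains, and the
   factor k (n + 1 - k) is 0. *)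
have {kn kn'} kn : k = n by apply/eqP; rewrite eqn_leq kn kn'.
rewrite E kn (@invariant_sets_gt n.+1)//.
have -> : near_invariant_sets n.+1 s = 0%N.
  apply: eq_card0 => B; rewrite !inE; apply/negbTE/nandP; left.
  by rewrite neq_ltn ltnS -[X in (_ <= X)%N](card_ord n) max_card.
under eq_bigr do rewrite (@invariant_sets_gt n.+1)//.
by rewrite big1//; ring.
Qed.

(** At the identity f_k is a binomial coefficient, and this is the ballot formula cleared of its
    denominator. The n + 1 spins of the Curie-Weiss model enter here, through the binomial
    coefficients of n + 1. *)
Lemma two_row_character1 k : (k <= n.+1)%N ->
  n.+1%:R * two_row_character k 1%g = (n.+1%:R - k.*2%:R) * 'C(n.+1, k)%:R :> R.
Proof.
move=> kn; rewrite /two_row_character invariant_sets1 -mul2n natrM mulrBr.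
have -> : n.+1%:R * 'C(n, k)%:R = (n.+1%:R - k%:R) * 'C(n.+1, k)%:R :> R.
  by rewrite -natrB// -!natrM -(mul_bin_down n.+1 k).
case: k kn => [|k] kn; first by rewrite !mulr0 !subr0.
have -> : n.+1%:R * (invariant_sets k (1%g : 'S_n))%:R = k.+1%:R * 'C(n.+1, k.+1)%:R :> R.
  by rewrite invariant_sets1 -!natrM -(mul_bin_diag n.+1 k).
ring.
Qed.

End specht.

(** * Cycles, invariant sets and spins *)

Section cycles.
Context (n : nat).
Implicit Types (s : 'S_n) (B : {set 'I_n}).

Lemma sum_cycles_of_length (w : nat -> nat) s :
  (\sum_(1 <= k < n.+1) w k * cycles_of_length k s = \sum_(c in porbits s) w #|c|)%N.
Proof.
under eq_bigr => k _.
  rewrite /cycles_of_length -sum1_card mulnC big_distrl/=.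
  rewrite (eq_bigl (fun c => (c \in porbits s) && (#|c| == k))); last by move=> c; rewrite inE.
  rewrite big_mkcondr/=; over.
rewrite exchange_big/=; apply: eq_bigr => _ /imsetP[i _ ->].
set c := #|_|; have c0 : (1 <= c < n.+1)%N.
  rewrite ltnS -[X in (_ <= _ <= X)%N](card_ord n) max_card andbT.
  by apply/card_gt0P; exists i; exact: porbit_id.
rewrite (bigD1_seq c) ?mem_index_iota ?iota_uniq//= eqxx mul1n big1 ?addn0// => k.
by rewrite eq_sym => /negPf ->.
Qed.

Lemma num_cyclesE s : num_cycles s = #|porbits s|.
Proof.
rewrite -sum1_card -(sum_cycles_of_length (fun=> 1%N)).
by apply: eq_bigr => k _; rewrite mul1n.
Qed.

Definition invariant s B := [forall i, (s i \in B) == (i \in B)].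

Lemma imset_eq_invariant s B : (s @: B == B) = invariant s B.
Proof.
apply/eqP/forallP => [sB i|H].
  by rewrite -{1}sB (mem_imset _ _ (@perm_inj _ s)).
apply/eqP; rewrite eqEcard card_imset ?leqnn ?andbT; last exact: perm_inj.
by apply/fintype.subsetP => _ /imsetP[x xB ->]; rewrite (eqP (H x)).
Qed.

Lemma invariant_porbit s B i j : invariant s B -> j \in porbit s i ->
  (j \in B) = (i \in B).
Proof.
move=> /forallP H /porbitP[k ->]; elim: k => [|k IH]; first by rewrite perm1.
by rewrite expgSr permM (eqP (H _)).
Qed.

(** An invariant set is a union of cycles, so [cover] is a bijection from the subsets of [porbits s]
    to the invariant sets. *)
Lemma card_invariant s : #|invariant s| = (2 ^ num_cycles s)%N.
Proof.
rewrite num_cyclesE -card_powerset -(card_in_imset (f := @finset.cover _)); last first.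
  move=> P Q; rewrite !inE => /fintype.subsetP Ps /fintype.subsetP Qs PQ.
  have main (X Y : {set {set 'I_n}}) : {subset X <= porbits s} -> {subset Y <= porbits s} ->
      finset.cover X = finset.cover Y -> {subset X <= Y}.
    move=> Xs Ys XY c cX; have /imsetP[i _ ci] := Xs _ cX.
    have : i \in finset.cover Y.
      by rewrite -XY; apply/bigcupP; exists c => //; rewrite ci porbit_id.
    move=> /bigcupP[c' c'Y ic']; have /imsetP[i' _ ci'] := Ys _ c'Y.
    by rewrite ci; move: c'Y ic'; rewrite ci' -eq_porbit_mem => + /eqP ->.
  by apply/finset.setP => c; apply/idP/idP; apply: main.
apply: eq_card => B; apply/idP/imsetP => [iB|[P]]; last first.
  rewrite inE => /fintype.subsetP Ps ->; apply/forallP => i; apply/eqP.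
  have porb c : c \in P -> (s i \in c) = (i \in c).
    move=> /Ps /imsetP[j _ ->]; rewrite -!eq_porbit_mem; congr (_ == _).
    by apply/eqP; rewrite eq_porbit_mem; have := mem_porbit s 1 i; rewrite expg1.
  by apply/bigcupP/bigcupP => -[c cP]; [rewrite porb// | rewrite -porb//]; exists c.
exists [set c in porbits s | c \subset B]%SET.
  by rewrite inE; apply/fintype.subsetP => c; rewrite !inE => /andP[].
apply/finset.setP => i; apply/idP/bigcupP => [iiB|[c]]; last first.
  by rewrite !inE => /andP[_ /fintype.subsetP H]; exact: H.
exists (porbit s i); last exact: porbit_id.
rewrite !inE imset_f//=; apply/fintype.subsetP => j ij.
by rewrite (invariant_porbit iB ij).
Qed.

Lemma sum_invariant_sets (R : pzSemiRingType) (w : nat -> R) s :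
  (\sum_(k < n.+1) w k * (invariant_sets k s)%:R = \sum_(B | invariant s B) w #|B|)%R.
Proof.
under eq_bigr => k _.
  rewrite /invariant_sets -sum_pred_card natr_sum mulr_sumr big_mkcond/=; over.
rewrite exchange_big/= [RHS]big_mkcond; apply: eq_bigr => B _.
have Bn : (#|B| < n.+1)%N by rewrite ltnS -[X in (_ <= X)%N](card_ord n) max_card.
rewrite (bigD1 (Ordinal Bn))//= eqxx big1 ?addr0; last first.
  by move=> k kB; case: eqP => // Bk; case/negP: kB; apply/eqP; apply: val_inj; rewrite /= Bk.
by rewrite imset_eq_invariant; case: ifP; rewrite ?mulr1 ?mulr0.
Qed.

End cycles.

Section cycle_moments.
Context (R : numDomainType) (n : nat).
Implicit Types (s : 'S_n) (B : {set 'I_n}).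
Local Open Scope ring_scope.

Let spin B i : R := (-1) ^+ (i \in B).

Let sum_spin B : \sum_i spin B i = n%:R - #|B|.*2%:R.
Proof.
rewrite (bigID (mem B))/= (eq_bigr (fun=> -1)); last by move=> i iB; rewrite /spin iB.
rewrite sumr_const mulNrn (eq_bigr (fun=> 1)); last by move=> i /negPf iB; rewrite /spin iB.
rewrite (eq_bigl (mem (~: B))); last by move=> i; rewrite !inE.
rewrite sumr_const -mul2n natrM.
have -> : n%:R = #|B|%:R + #|~: B|%:R :> R by rewrite -natrD cardsC card_ord.
ring.
Qed.

(* If [i] and [j] lie in different cycles, toggling the cycle of [i] in [B]
   changes the sign of the product. *)
Let sum_spin_spin s i j :
  \sum_(B | invariant s B) spin B i * spin B j = (2 ^ num_cycles s * (j \in porbit s i))%:R.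
Proof.
have [ij|ij] := boolP (j \in porbit s i).
  rewrite muln1 -card_invariant -sum1_card natr_sum; apply: eq_bigr => B iB.
  by rewrite /spin (invariant_porbit iB ij) -signr_addb addbb.
rewrite muln0; apply/eqP.
pose t B := [set x | (x \in B) (+) (x \in porbit s i)]%SET.
have tK : involutive t.
  by move=> B; apply/finset.setP => x; rewrite !inE -addbA addbb addbF.
have it B : invariant s (t B) = invariant s B.
  apply: eq_forallb => x; rewrite !inE.
  have -> : (s x \in porbit s i) = (x \in porbit s i).
    rewrite -!eq_porbit_mem; congr (_ == _); apply/eqP; rewrite eq_porbit_mem.
    by have := mem_porbit s 1 x; rewrite expg1.
  by do 3!case: (_ \in _).
have E : \sum_(B | invariant s B) spin B i * spin B j =
    - \sum_(B | invariant s B) spin B i * spin B j.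
  rewrite {1}(reindex_inj (inv_inj tK)) -sumrN; apply: eq_big => // B _.
  by rewrite /spin !inE porbit_id (negPf ij) addbF addbT signrN mulNr.
by have /eqP := E; rewrite -addr_eq0 -mulr2n mulrn_eq0.
Qed.

(** n - 2 |B| is the total spin of B. In the expanded square only pairs i, j in a common cycle
    survive, and there are sum_k k^2 alpha_k of them. *)
Lemma sum_invariant_sqr s :
  \sum_(B | invariant s B) (n%:R - #|B|.*2%:R) ^+ 2 =
  ((\sum_(1 <= k < n.+1) k ^ 2 * cycles_of_length k s) * 2 ^ num_cycles s)%:R :> R.
Proof.
transitivity (\sum_(B | invariant s B) \sum_i \sum_j spin B i * spin B j).
  apply: eq_bigr => B _; rewrite -sum_spin expr2 mulr_suml; apply: eq_bigr => i _.
  by rewrite mulr_sumr.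
rewrite exchange_big/=.
under eq_bigr do rewrite exchange_big/=.
under eq_bigr do under eq_bigr do rewrite sum_spin_spin.
under eq_bigr do rewrite -natr_sum.
rewrite -natr_sum; congr (_%:R).
under eq_bigr do rewrite -big_distrr/=.
rewrite -big_distrr/= mulnC; congr (_ * _)%N.
rewrite (sum_cycles_of_length (fun k => k ^ 2)%N).
rewrite (partition_big_imset (porbit s))/=; apply: eq_big => // _ /imsetP[i _ ->].
rewrite -mulnn -sum_nat_const; apply: eq_big => j.
  by rewrite eq_porbit_mem.
move=> /eqP <-; rewrite -sum1_card [RHS]big_mkcond/=.
by apply: eq_bigr => k _; case: (_ \in _).
Qed.

End cycle_moments.

(** * The Curie-Weiss model *)

Local Open Scope classical_set_scope.
Local Open Scope ring_scope.

(** * Hyperbolic functions *)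

Section hyperbolic.
Context (R : realType).
Implicit Types x y : R.

Lemma ge0_of_derive_ge0 (f f' : R -> R) :
  (forall x, is_derive x 1 f (f' x)) -> (forall x, 0 <= x -> 0 <= f' x) ->
  f 0 = 0 -> forall x, 0 <= x -> 0 <= f x.
Proof.
move=> df f'0 f0 x x0.
rewrite -f0; apply: (@ger0_derive1_le_cc R f 0 x).
- by move=> z zin; have [] := df z.
- by move=> z; rewrite in_itv/= => /andP[z0 _]; rewrite derive1E derive_val f'0 ?ltW.
- apply: derivable_within_continuous => z _; by have [] := df z.
- by rewrite in_itv/= lexx.
- by rewrite in_itv/= x0 lexx.
- by [].
Qed.

Definition cosh x := (expR x + expR (- x)) / 2.
Definition sinh x := (expR x - expR (- x)) / 2.

Lemma coshDsinh x : cosh x + sinh x = expR x.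
Proof. by rewrite /cosh /sinh; field. Qed.

Lemma coshBsinh x : cosh x - sinh x = expR (- x).
Proof. by rewrite /cosh /sinh; field. Qed.

Lemma coshN x : cosh (- x) = cosh x.
Proof. by rewrite /cosh opprK addrC. Qed.

Lemma sinhN x : sinh (- x) = - sinh x.
Proof. by rewrite /sinh opprK -mulNr opprB. Qed.

Lemma cosh_gt0 x : 0 < cosh x.
Proof. by rewrite divr_gt0// addr_gt0// expR_gt0. Qed.

Lemma sinh_ge x : 0 <= x -> x <= sinh x.
Proof.
move=> x0; rewrite -subr_ge0; pose f z := sinh z - z.
rewrite -/(f x); apply: (@ge0_of_derive_ge0 f (fun z => cosh z - 1)) x x0.
- move=> z; rewrite /f /sinh; apply: is_derive_eq => /=.
  rewrite /cosh /GRing.scale/=; ring.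
- move=> z _; rewrite /cosh.
  have -> : (expR z + expR (- z)) / 2 - 1 =
      (expR (z / 2) - expR (- (z / 2))) ^+ 2 / 2.
    have e1 : expR z = expR (z/2) ^+ 2 by rewrite -expRM_natr divfK.
    have e2 : expR (-z) = expR (-(z/2)) ^+ 2.
      by rewrite -expRM_natr mulNr divfK.
    have := expRxMexpNx_1 (z / 2).
    rewrite e1 e2 => H; rewrite [RHS]mulrC sqrrB H; by field.
  by rewrite divr_ge0// sqr_ge0.
- by rewrite /f /sinh !oppr0 subrr mul0r addr0.
Qed.

Lemma sinh_ge0 x : 0 <= x -> 0 <= sinh x.
Proof. by move=> x0; apply: le_trans (sinh_ge x0). Qed.

Lemma sinh_le x : 0 <= x -> sinh x <= x * cosh x.
Proof.
move=> x0; rewrite -subr_ge0; pose f z := z * cosh z - sinh z.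
rewrite -/(f x); apply: (@ge0_of_derive_ge0 f (fun z => z * sinh z)) x x0.
- move=> z; rewrite /f /sinh /cosh; apply: is_derive_eq => /=.
  rewrite /GRing.scale/=; by field.
- by move=> z z0; rewrite mulr_ge0// sinh_ge0.
- by rewrite /f /sinh oppr0 subrr !mul0r oppr0 addr0.
Qed.

Lemma cosh_ge x : 1 + x ^+ 2 / 2 <= cosh x.
Proof.
wlog x0 : x / 0 <= x.
  by move=> H; case: (leP 0 x) => [/H//|/ltW x0]; rewrite -coshN -sqrrN H ?oppr_ge0.
have h0 : 0 <= x / 2 by rewrite divr_ge0.
have -> : cosh x = 1 + 2 * sinh (x / 2) ^+ 2.
  rewrite /cosh /sinh.
  have e1 : expR x = expR (x/2) ^+ 2 by rewrite -expRM_natr divfK.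
  have e2 : expR (-x) = expR (-(x/2)) ^+ 2 by rewrite -expRM_natr mulNr divfK.
  have := expRxMexpNx_1 (x / 2); rewrite e1 e2 => H.
  rewrite expr_div_n sqrrB H; by field.
rewrite lerD2l; have := sinh_ge h0 => H.
have : (x / 2) ^+ 2 <= sinh (x / 2) ^+ 2 by rewrite ler_sqr ?nnegrE// sinh_ge0.
rewrite expr_div_n; lra.
Qed.

Lemma cosh_ge1 x : 1 <= cosh x.
Proof. by apply: le_trans (cosh_ge x); rewrite lerDl divr_ge0// sqr_ge0. Qed.

Lemma cosh_le_expR x y : `|x| <= y -> cosh x <= expR y.
Proof.
rewrite ler_norml => /andP[h1 h2]; rewrite /cosh ler_pdivrMr// mulr_natr mulr2n.
by rewrite lerD// ler_expR// lerNl.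
Qed.

Lemma mulr_sinh_ge0 x : 0 <= x * sinh x.
Proof.
case: (leP 0 x) => [x0|/ltW x0]; first by rewrite mulr_ge0// sinh_ge0.
by rewrite -mulrNN -sinhN mulr_ge0// ?sinh_ge0 ?oppr_ge0.
Qed.

Lemma mulr_sinh_le x : x * sinh x <= x ^+ 2 * cosh x.
Proof.
wlog x0 : x / 0 <= x.
  move=> H; case: (leP 0 x) => [/H//|/ltW x0].
  by rewrite -mulrNN -sinhN -coshN -sqrrN H ?oppr_ge0.
by rewrite expr2 -mulrA ler_wpM2l// sinh_le.
Qed.

End hyperbolic.

(** * Sums of independent signs and their Curie-Weiss weights *)

Section curie_weiss.
Context (R : realType).
Implicit Types (phi psi : R -> R) (N : nat) (t h x : R).

(** 2 ^ N times the expectation of phi at a sum of N independent signs; j counts the minus signs. *)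
Definition spin_sum N phi : R :=
  \sum_(j < N.+1) 'C(N, j)%:R * phi (N%:R - (j.*2)%:R).

(** With x = N - 2 j the two sides agree term by term after a shift of j, because (j + 1) C(N, j +
    1) = (N - j) C(N, j). *)
Lemma spin_sum_shift N psi :
  spin_sum N (fun x => (N%:R - x) * psi (x + 1)) =
  spin_sum N (fun x => (N%:R + x) * psi (x - 1)).
Proof.
rewrite /spin_sum big_ord_recl [RHS]big_ord_recr/= double0 subr0 subrr mul0r mulr0.
rewrite add0r -mul2n natrM [X in _ = _ + X](_ : _ = 0) ?addr0; last by lra.
apply: eq_bigr => i _; rewrite /bump/= add1n.
have -> : N%:R - (i.+1).*2%:R + 1 = N%:R - (i.*2)%:R - 1 :> R.
  rewrite -!mul2n !natrM -natr1; ring.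
rewrite subKr !mulrA; congr (_ * _).
have H := mul_bin_left N i.
have iN : (i <= N)%N by rewrite ltnW.
have : (i.+1 * 'C(N, i.+1))%:R = ((N - i) * 'C(N, i))%:R :> R by rewrite H.
rewrite !natrM natrB// -!mul2n !natrM -natr1 => E.
have -> : N%:R + (N%:R - 2 * i%:R) = 2 * (N%:R - i%:R) :> R by ring.
rewrite mulrCA -/(_ * _) [in RHS]mulrCA [in RHS](mulrC _ (N%:R - _)) -E; ring.
Qed.

Lemma eq_spin_sum N phi psi : phi =1 psi -> spin_sum N phi = spin_sum N psi.
Proof. by move=> e; apply: eq_bigr => i _; rewrite e. Qed.

Lemma spin_sumD N phi psi :
  spin_sum N (fun x => phi x + psi x) = spin_sum N phi + spin_sum N psi.
Proof. by rewrite /spin_sum -big_split; apply: eq_bigr => i _; rewrite mulrDr. Qed.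

Lemma spin_sumZ N a phi : spin_sum N (fun x => a * phi x) = a * spin_sum N phi.
Proof. by rewrite /spin_sum mulr_sumr; apply: eq_bigr => i _; rewrite mulrCA. Qed.

Lemma spin_sumB N phi psi :
  spin_sum N (fun x => phi x - psi x) = spin_sum N phi - spin_sum N psi.
Proof.
rewrite spin_sumD -[in RHS]mulN1r -spin_sumZ; congr (_ + _).
by apply: eq_spin_sum => x; rewrite mulN1r.
Qed.

Lemma ler_spin_sum N phi psi : (forall x, `|x| <= N%:R -> phi x <= psi x) ->
  spin_sum N phi <= spin_sum N psi.
Proof.
move=> H; apply: ler_sum => i _; rewrite ler_wpM2l//; apply: H.
have iN : (i <= N)%N by rewrite -ltnS.
have : i%:R <= N%:R :> R by rewrite ler_nat.
have : 0 <= i%:R :> R by [].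
rewrite -mul2n natrM ler_norml; lra.
Qed.

(** [spin_sum_shift] with the terms in N and the terms in x collected on opposite sides: a discrete
    integration by parts. *)
Lemma spin_sum_stein N psi :
  spin_sum N (fun x => x * (psi (x + 1) + psi (x - 1))) =
  N%:R * spin_sum N (fun x => psi (x + 1) - psi (x - 1)).
Proof.
rewrite -spin_sumZ; apply/eqP; rewrite -subr_eq0 -spin_sumB.
have /eqP := spin_sum_shift N psi; rewrite eq_sym -subr_eq0 -spin_sumB => /eqP E.
by rewrite -[0]E; apply/eqP/eq_spin_sum => x; ring.
Qed.

Lemma spin_sum_expR N h : spin_sum N (fun x => expR (h * x)) = (2 * cosh h) ^+ N.
Proof.
rewrite /cosh mulrC divfK// exprDn; apply: eq_bigr => i _.
have iN : (i <= N)%N by rewrite -ltnS.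
rewrite -[RHS]mulr_natl; congr (_ * _).
rewrite -!expRM_natr -expRD natrB// -mul2n natrM; congr expR; ring.
Qed.

(** Under the tilt exp(h x) the spins stay independent with mean tanh h, so the second moment is N +
    N (N - 1) tanh(h)^2. Two integrations by parts produce this value. *)
Lemma spin_sum_sqr_expR N h : N%:R * (2 * cosh h) ^+ N <=
  spin_sum N (fun x => x ^+ 2 * expR (h * x)).
Proof.
case: N => [|N].
  by rewrite mul0r sumr_ge0// => i _; rewrite mulr_ge0// mulr_ge0 ?sqr_ge0 ?expR_ge0.
set M := N.+1; rewrite -spin_sum_expR.
set e0 := spin_sum M _; set e2 := spin_sum M _.
pose e1 := spin_sum M (fun x => x * expR (h * x)).
have shift x : (expR (h * (x + 1)) = expR (h * x) * (cosh h + sinh h)) *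
               (expR (h * (x - 1)) = expR (h * x) * (cosh h - sinh h)).
  by rewrite coshDsinh coshBsinh -!expRD mulrDr mulrBr mulr1.
have c0 := cosh_gt0 h.
have H1 : cosh h * e1 = M%:R * (sinh h * e0).
  have := spin_sum_stein M (fun x => expR (h * x)) => E.
  rewrite -!spin_sumZ; apply: (mulfI (_ : 2 != 0 :> R)) => //.
  rewrite -!spin_sumZ; move: E; rewrite -!spin_sumZ => E.
  transitivity (spin_sum M (fun x => x * (expR (h * (x + 1)) + expR (h * (x - 1))))).
    by apply: eq_spin_sum => x; rewrite !shift; ring.
  by rewrite E; apply: eq_spin_sum => x; rewrite !shift; ring.
have H2 : cosh h * e2 + sinh h * e1 = M%:R * (sinh h * e1 + cosh h * e0).
  have := spin_sum_stein M (fun x => x * expR (h * x)) => E.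
  rewrite -!spin_sumZ -!spin_sumD -spin_sumZ.
  apply: (mulfI (_ : 2 != 0 :> R)) => //.
  rewrite -!spin_sumZ; move: E; rewrite -!spin_sumZ => E.
  transitivity (spin_sum M (fun x => x * ((x + 1) * expR (h * (x + 1)) + (x - 1) * expR (h * (x - 1))))).
    by apply: eq_spin_sum => x; rewrite !shift; ring.
  by rewrite E; apply: eq_spin_sum => x; rewrite !shift; ring.
rewrite -subr_ge0 -(pmulr_rge0 _ c0) -(pmulr_rge0 _ c0).
have -> : cosh h * (cosh h * (e2 - M%:R * e0)) = N%:R * M%:R * (sinh h ^+ 2 * e0).
  transitivity (cosh h * (cosh h * e2 + sinh h * e1) - sinh h * (cosh h * e1)
    - cosh h ^+ 2 * M%:R * e0); first by ring.
  rewrite H2; transitivity ((M%:R - 1) * sinh h * (cosh h * e1)); first by ring.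
  rewrite H1 /M -natr1; ring.
apply: mulr_ge0; first exact: mulr_ge0.
apply: mulr_ge0; first exact: sqr_ge0.
by apply: sumr_ge0 => i _; rewrite mulr_ge0 ?expR_ge0.
Qed.

Lemma spin_sum_sqr N : spin_sum N (fun x => x ^+ 2) = N%:R * 2 ^+ N.
Proof.
have := spin_sum_stein N id => E.
have E1 := spin_sum_expR N 0.
apply: (mulfI (_ : 2 != 0 :> R)) => //; rewrite -spin_sumZ.
transitivity (spin_sum N (fun x => x * (x + 1 + (x - 1)))).
  by apply: eq_spin_sum => x; ring.
rewrite E mulrCA; congr (_ * _).
transitivity (spin_sum N (fun x => 2 * expR (0 * x))).
  by apply: eq_spin_sum => x; rewrite mul0r expR0; ring.
by rewrite spin_sumZ E1 /cosh oppr0 expR0; congr (_ * _ ^+ _); field.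
Qed.

(** For N spins this is exp(beta x^2 / (2 N)) with beta = N t / 2; the critical point beta = 1 is N
    t = 2. *)
Definition curie_weiss t x : R := expR (t * x ^+ 2 / 4).

Lemma curie_weissD t x : curie_weiss t (x + 1) =
  expR (t / 4) * curie_weiss t x * (cosh (t * x / 2) + sinh (t * x / 2)).
Proof. by rewrite coshDsinh -!expRD; congr expR; field. Qed.

Lemma curie_weissB t x : curie_weiss t (x - 1) =
  expR (t / 4) * curie_weiss t x * (cosh (t * x / 2) - sinh (t * x / 2)).
Proof. by rewrite coshBsinh -!expRD; congr expR; field. Qed.

Lemma curie_weiss_high_temperature N t : 0 <= t -> N%:R * t < 2 ->
  (1 - N%:R * t / 2) * spin_sum N (fun x => x ^+ 4 * curie_weiss t x) <=
  3 * N%:R * expR (N%:R * t / 2) * spin_sum N (fun x => x ^+ 2 * curie_weiss t x).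
Proof.
move=> t0 Nt; set del := 1 - _.
have del0 : 0 < del by rewrite /del; lra.
pose c x := cosh (t * x / 2); pose s x := sinh (t * x / 2).
(* The polynomial vanishes at -1, 0 and 1, so its shifts x (x + 1) (x + 2) and x (x - 1) (x - 2)
   leave no constant term, which could not be compared with x^2. *)
pose psi x := (x ^+ 3 - x) * curie_weiss t x.
have key : del * spin_sum N (fun x => x ^+ 4 * (c x * curie_weiss t x)) <=
    3 * N%:R * spin_sum N (fun x => x ^+ 2 * (c x * curie_weiss t x)).
  rewrite -subr_ge0 -!spin_sumZ -spin_sumB.
  rewrite -(pmulr_rge0 _ (_ : 0 < 2 * expR (t / 4))); last first.
    by rewrite mulr_gt0// expR_gt0.
  rewrite -spin_sumZ.
  have /eqP := spin_sum_stein N psi; rewrite eq_sym -subr_eq0 -spin_sumZ -spin_sumB.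
  move=> /eqP <-; apply: ler_spin_sum => x _.
  rewrite /psi curie_weissD curie_weissB -/(c x) -/(s x).
  set q := curie_weiss t x; set k := expR (t / 4).
  have kq0 : 0 <= k * q by rewrite mulr_ge0 ?expR_ge0.
  rewrite -subr_ge0.
  (* The claim minus the integration by parts is a sum of three nonnegative terms; the first one
     rests on x sinh(t x / 2) <= (t / 2) x^2 cosh(t x / 2), the source of [del]. *)
  have -> : 2 * k * (3 * N%:R * (x ^+ 2 * (c x * q)) - del * (x ^+ 4 * (c x * q))) -
     (N%:R * (((x + 1) ^+ 3 - (x + 1)) * (k * q * (c x + s x)) -
      ((x - 1) ^+ 3 - (x - 1)) * (k * q * (c x - s x))) -
      x * (((x + 1) ^+ 3 - (x + 1)) * (k * q * (c x + s x)) +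
       ((x - 1) ^+ 3 - (x - 1)) * (k * q * (c x - s x)))) =
    k * q * ((2 * x ^+ 2 + 4) * N%:R * (t / 2 * x ^+ 2 * c x - x * s x) +
      4 * del * (x ^+ 2 * c x) + 6 * x ^+ 2 * (x * s x)).
    by rewrite /del; field.
  have cx0 : 0 < c x by exact: cosh_gt0.
  have [xs0 xs] : 0 <= x * s x /\ x * s x <= t / 2 * x ^+ 2 * c x.
    move: t0; rewrite le_eqVlt => /predU1P[t0|t0].
      rewrite /s -t0 !mul0r /sinh oppr0 subrr !mul0r mulr0; split => //.
    have h0 : 0 < t / 2 by rewrite divr_gt0.
    have e1 : t / 2 * (x * s x) = t * x / 2 * s x by field.
    have e2 : t / 2 * (t / 2 * x ^+ 2 * c x) = (t * x / 2) ^+ 2 * c x by field.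
    split; first by rewrite -(pmulr_rge0 _ h0) e1 mulr_sinh_ge0.
    by rewrite -(ler_pM2l h0) e1 e2 mulr_sinh_le.
  apply: mulr_ge0 => //; apply: addr_ge0; first apply: addr_ge0.
  - apply: mulr_ge0; last by rewrite subr_ge0.
    by apply: mulr_ge0 => //; rewrite addr_ge0// mulr_ge0// sqr_ge0.
  - apply: mulr_ge0; first by rewrite mulr_ge0// ltW.
    by apply: mulr_ge0; [exact: sqr_ge0 | exact: ltW].
  - by apply: mulr_ge0 => //; apply: mulr_ge0 => //; exact: sqr_ge0.
(* The factor [c x] is removed from [key]: it is at least 1 on the left and, as |x| <= N, at most
   exp(N t / 2) on the right. *)
apply: (@le_trans _ _ (del * spin_sum N (fun x => x ^+ 4 * (c x * curie_weiss t x)))).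
  rewrite ler_pM2l//; apply: ler_spin_sum => x _.
  rewrite ler_wpM2l ?exprn_even_ge0// ler_peMl ?expR_ge0//; exact: cosh_ge1.
apply: le_trans key _; rewrite -[leRHS]mulrA ler_wpM2l ?mulr_ge0//.
rewrite -spin_sumZ; apply: ler_spin_sum => x xN.
rewrite [leRHS]mulrCA ler_wpM2l ?sqr_ge0// ler_wpM2r ?expR_ge0//.
apply: cosh_le_expR; rewrite normrM normfV normrM.
rewrite (ger0_norm t0) (ger0_norm (ler0n _ 2)) ler_wpM2r// ?invr_ge0//.
by rewrite mulrC ler_wpM2r.
Qed.

(** m is the mean of x^2 under the law proportional to x^2 exp(t x^2 / 4). Jensen's inequality for
    exp(- t x^2 / 4) under this law bounds the normalisation above by N 2^N exp(t m / 4); the tilted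
    second moment bounds it below. *)
Lemma curie_weiss_tilt N t h : 0 < t -> (0 < N)%N ->
  let m := spin_sum N (fun x => x ^+ 4 * curie_weiss t x) /
           spin_sum N (fun x => x ^+ 2 * curie_weiss t x) in
  0 < spin_sum N (fun x => x ^+ 2 * curie_weiss t x) /\
  cosh h ^+ N * expR (- (h ^+ 2 / t)) <= expR (t * m / 4).
Proof.
move=> t0 N0 m; rewrite /m {m}.
set Z := spin_sum N (fun x => x ^+ 2 * curie_weiss t x).
set A := spin_sum N (fun x => x ^+ 4 * curie_weiss t x).
set m := A / Z.
have lo : N%:R * (2 * cosh h) ^+ N * expR (- (h ^+ 2 / t)) <= Z.
  apply: (@le_trans _ _ (spin_sum N (fun x => expR (- (h ^+ 2 / t)) * (x ^+ 2 * expR (h * x))))).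
    by rewrite spin_sumZ mulrC ler_wpM2l ?expR_ge0// spin_sum_sqr_expR.
  apply: ler_spin_sum => x _; rewrite mulrCA ler_wpM2l ?sqr_ge0// -expRD ler_expR.
  (* Completing the square linearises the exponent. *)
  have -> : t * x ^+ 2 / 4 = (t * x / 2 - h) ^+ 2 / t + (- (h ^+ 2 / t) + h * x).
    by field; rewrite gt_eqF.
  by rewrite lerDr divr_ge0 ?sqr_ge0 ?ltW.
have N0' : 0 < N%:R :> R by rewrite ltr0n.
have Z0 : 0 < Z.
  apply: lt_le_trans lo.
  by rewrite mulr_gt0 ?expR_gt0// mulr_gt0// exprn_gt0// mulr_gt0// cosh_gt0.
split => //.
have N2 : 0 < N%:R * 2 ^+ N :> R by rewrite mulr_gt0// exprn_gt0.
rewrite -(ler_pM2l N2); apply: (@le_trans _ _ Z).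
  have e : (2 * cosh h) ^+ N = 2 ^+ N * cosh h ^+ N by rewrite exprMn.
  by apply: le_trans lo; rewrite e !mulrA lexx.
rewrite -spin_sum_sqr mulrC -ler_pdivrMl ?expR_gt0// -expRN.
(* Jensen's inequality via the tangent 1 + y <= exp y at y = t m / 4 - t x^2 / 4: the choice of m
   makes the linear term average to 0. *)
have -> : expR (- (t * m / 4)) * Z =
    spin_sum N (fun x => expR (- (t * m / 4)) * (x ^+ 2 * curie_weiss t x *
       (1 + (t * m / 4 - t * x ^+ 2 / 4)))).
  rewrite spin_sumZ; congr (_ * _).
  transitivity (spin_sum N (fun x => (1 + t * m / 4) * (x ^+ 2 * curie_weiss t x) - t / 4 * (x ^+ 4 * curie_weiss t x))).
    rewrite spin_sumB !spin_sumZ -/A -/Z mulrDl mul1r.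
    have -> : A = m * Z by rewrite /m divfK// gt_eqF.
    by field.
  by apply: eq_spin_sum => x; field.
apply: ler_spin_sum => x _.
rewrite [leLHS](_ : _ = x ^+ 2 * (expR (- (t * m / 4)) * (curie_weiss t x *
  (1 + (t * m / 4 - t * x ^+ 2 / 4))))); last by ring.
rewrite -[leRHS]mulr1 ler_wpM2l ?sqr_ge0//.
apply: (@le_trans _ _ (expR (- (t * m / 4)) * (curie_weiss t x * expR (t * m / 4 - t * x ^+ 2 / 4)))).
  by rewrite ler_wpM2l ?expR_ge0// ler_wpM2l ?expR_ge0// expR_ge1Dx.
rewrite /curie_weiss -!expRD [X in expR X](_ : _ = 0) ?expR0//; ring.
Qed.

End curie_weiss.

(** * The law of the interchange process *)

(** u is the supremum of the times in [a, b] at which f still equals f a; right continuity excludes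
    that f u = f a. *)
Lemma first_jump (R : realType) (f : R -> nat) (a b : R) :
  0 <= a -> a <= b ->
  (forall s t, 0 <= s -> s <= t -> (f s <= f t)%N) ->
  (forall t, 0 <= t -> \forall s \near t^'+, f s = f t) ->
  f b = (f a).+1 ->
  exists u, [/\ a < u, u <= b, f u = (f a).+1 &
    forall s, a <= s -> s < u -> f s = f a].
Proof.
move=> a0 ab mono rc fb.
pose S := [set s | a <= s <= b /\ f s = f a].
have Sa : S a by rewrite /S/= lexx ab.
have Sub : ubound S b by move=> s [/andP[]].
pose u := sup S.
have au : a <= u by apply: ub_le_sup => //; exists b.
have ub : u <= b by apply: ge_sup => //; exists a.
have before s : a <= s -> s < u -> f s = f a.
  move=> as_ su; have [y [/andP[ay yb] fy] sy] := sup_gt (ex_intro _ a Sa) su.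
  apply/eqP; rewrite eqn_leq; apply/andP; split; last exact: mono.
  by rewrite -fy; apply: mono; [exact: le_trans as_ | exact: ltW].
have u0 : 0 <= u := le_trans a0 au.
have fu : f u <> f a.
  move=> fua; have ltub : u < b.
    rewrite lt_neqAle ub andbT; apply/eqP => uEb.
    by move: fb; rewrite -uEb fua => /n_Sn.
  have [s [fs [sb us]]] := @filter_ex _ _ (at_right_proper_filter u) _ (filterI (rc u u0)
    (filterI (nbhs_right_lt ltub) (nbhs_right_gt u))).
  have : s <= u.
    apply: ub_le_sup; first by exists b.
    by rewrite /S/= fs fua (le_trans au (ltW us)) (ltW sb).
  by rewrite leNgt us.
exists u; split => //.
- by rewrite lt_neqAle au andbT; apply/eqP => aEu; apply: fu; rewrite -aEu.
- apply/eqP; rewrite eqn_leq -fb mono//= fb ltn_neqAle mono// andbT.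
  by apply/eqP => H; apply: fu.
Qed.

(** * Following one path along a time grid *)

Section path.
Context (n : nat) (R : realType) (N : edge n -> R -> nat) (pi : R -> 'S_n).
Hypothesis N_mono : forall e s t, 0 <= s -> s <= t -> (N e s <= N e t)%N.
Hypothesis N_rc : forall e t, 0 <= t -> \forall s \near t^'+, N e s = N e t.
Hypothesis pi_constant : forall s t : R, 0 <= s -> s <= t ->
  (forall e u, s < u -> u <= t -> ~ rings (N e) u) -> pi t = pi s.
Hypothesis pi_jump : forall (e : edge n) (t : R), rings (N e) t ->
  \forall u \near t^'-, pi t = (pi u * transposition e)%g.

(** [None] stands for a time interval without rings, [Some e] for one in which e rings once and no
    other clock rings. *)
Definition step (o : option (edge n)) : 'S_n :=
  if o is Some e then transposition e else 1%g.

Lemma not_rings e a b u : 0 <= a -> a < u -> u <= b -> N e b = N e a ->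
  ~ rings (N e) u.
Proof.
move=> a0 au ub Eab [_ /(_ a a0 au)].
by rewrite ltnNge -Eab N_mono// (le_trans a0)// ltW.
Qed.

Lemma path_step a b o : 0 <= a -> a <= b ->
  (forall e, N e b = N e a + (o == Some e))%N -> pi b = (pi a * step o)%g.
Proof.
case: o => [e0|] a0 ab Nab; last first.
  rewrite /= mulg1; apply: pi_constant => // e u au ub.
  by apply: (not_rings a0 au ub); rewrite Nab addn0.
have Ne0 : N e0 b = (N e0 a).+1 by rewrite Nab eqxx addn1.
have [u [au ub Nu before]] := first_jump a0 ab (@N_mono e0) (@N_rc e0) Ne0.
have u0 : 0 <= u := le_trans a0 (ltW au).
have other e v : e != e0 -> a < v -> v <= b -> ~ rings (N e) v.
  move=> ee0 av vb; apply: (not_rings a0 av vb).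
  by rewrite Nab (_ : (Some e0 == Some e) = (e0 == e))// eq_sym (negPf ee0) addn0.
have -> : pi b = pi u.
  apply: pi_constant => // e v uv vb; have [->|ee0] := eqVneq e e0.
    by apply: (not_rings u0 uv vb); rewrite Ne0 Nu.
  by apply: other => //; exact: lt_trans uv.
have ring_u : rings (N e0) u.
  split; first exact: le_lt_trans au.
  move=> s s0 su; rewrite Nu ltnS; have [as_|/ltW sa] := leP a s.
    by rewrite before.
  exact: N_mono.
(* [pi_jump] compares u only with times close below it; such a time v after a is joined to a by
   constancy. *)
have [v [-> [av vu]]] := @filter_ex _ _ (at_left_proper_filter u) _ (filterI (pi_jump ring_u)
  (filterI (nbhs_left_gt au) (nbhs_left_lt u))).
rewrite /step; congr (_ * _)%g.
apply: pi_constant; [exact: a0 | exact: ltW | move=> e x ax xv].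
have xu : x < u by exact: le_lt_trans vu.
have [->|ee0] := eqVneq e e0; last by apply: other => //; rewrite ltW// (lt_le_trans xu).
by move=> [_ /(_ a a0 ax)]; rewrite before ?ltnn// ltW.
Qed.

Lemma path_steps h (v : seq (option (edge n))) : 0 <= h ->
  (forall i e, (i < size v)%N ->
    N e (i.+1%:R * h) = N e (i%:R * h) + (nth None v i == Some e))%N ->
  pi ((size v)%:R * h) = (pi 0 * \prod_(o <- v) step o)%g.
Proof.
move=> h0; elim/last_ind: v => [|v o IH] H.
  by rewrite mul0r big_nil mulg1.
rewrite size_rcons -cats1 big_cat big_seq1/= mulgA -IH; last first.
  move=> i e iv; rewrite H ?size_rcons 1?ltnW//.
  by rewrite nth_rcons iv.
apply: path_step; rewrite ?mulr_ge0//.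
  by rewrite ler_wpM2r// ler_nat.
by move=> e; rewrite H ?size_rcons// nth_rcons ltnn eqxx.
Qed.

End path.

(** * Probabilities of ring patterns and the law of the permutation *)

Section patterns.
Context (n : nat) d (T : measurableType d) (R : realType).
Context (P : probability T R).
Context (N : edge n -> R -> {RV P >-> nat}) (pi : R -> T -> 'S_n).
Hypothesis ip : interchange_process N pi.

Lemma poisson_prob_bool (h : R) (b : bool) : 0 <= h ->
  poisson_prob h 0%N [set (b : nat)] = (h ^+ b * expR (- h))%:E.
Proof.
move=> h0; rewrite /poisson_prob; case: ltP => [hp|hn].
  by rewrite esum_set1 ?lee_fin ?poisson_pmf_ge0// /poisson_pmf hp (_ : b`! = 1%N) ?divr1//; case: b.
(* At rate 0 [poisson_prob] is the Dirac mass at 0, in agreement with the formula. *)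
have -> : h = 0 by apply/eqP; rewrite eq_le h0 hn.
rewrite oppr0 expR0 mulr1 diracE; case: b => /=.
  by rewrite expr1 memNset.
by rewrite expr0 mem_set.
Qed.

Definition increments_eq m (t : nat -> R) (c : 'I_m -> nat) e : set T :=
  \bigcap_(i in [set` [set: 'I_m]%SET])
    (fun w => (N e (t i.+1) w - N e (t i) w)%N) @^-1` [set c i].

Lemma sigma_process_increments m (t : nat -> R) (c : 'I_m -> nat) e :
  (forall i, 0 <= t i) -> sigma_process (N e) (increments_eq t c e).
Proof.
move=> t0; rewrite /sigma_process.
set G := \bigcup_(_ in _) _.
have mN s (A : set nat) : 0 <= s ->
    @measurable _ (g_sigma_algebraType G) ((N e s : T -> nat) @^-1` A).
  move=> s0; apply: sub_sigma_algebra; exists s => //=.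
  by exists A => //; rewrite setTI.
apply: (@fin_bigcap_measurable _ (g_sigma_algebraType G)).
  exact: finite_finset.
move=> i _; rewrite [X in measurable X](_ : _ = \bigcup_x
    (((N e (t i) : T -> nat) @^-1` [set x]) `&`
     ((N e (t i.+1) : T -> nat) @^-1` [set y | (y - x)%N = c i]))).
  by apply: bigcup_measurable => x _; apply: measurableI; exact: mN.
apply/seteqP; split => w /=; first by move=> H; exists (N e (t i) w).
by move=> [x _ [/= <-]].
Qed.

Lemma prob_increments m (t : nat -> R) (c : 'I_m -> edge n -> bool) :
  0 <= t 0%N -> (forall i, t i <= t i.+1) ->
  P (\bigcap_(e in [set` [set: edge n]%SET])
       increments_eq t (fun i => c i e : nat) e) =
  (\prod_(i < m) \prod_(e : edge n)
     ((t i.+1 - t i) ^+ c i e * expR (- (t i.+1 - t i))))%:E.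
Proof.
move=> t0 tS.
have ti i : 0 <= t i by elim: i => // i IH; exact: le_trans (tS i).
rewrite (clocks_independent ip); last by move=> e _; exact: sigma_process_increments.
rewrite exchange_big -prodEFin/=; apply: eq_big => [e|e _]; first by rewrite inE.
have pp := clocks_poisson ip e.
rewrite (poisson_independent_increments pp t0 tS); last first.
  by move=> i _; exists [set (c i e : nat)] => //; rewrite setTI.
rewrite -prodEFin; apply: eq_big => [i|i _]; first by rewrite inE.
by rewrite (poisson_increment pp)// mul1r poisson_prob_bool// subr_ge0.
Qed.

(** At most one ring occurs in each of the m intervals of length h, and v tells which. Paths with
    several rings in one interval belong to no pattern. *)
Definition pattern (h : R) m (v : m.-tuple (option (edge n))) : set T :=
  [set w | forall (i : 'I_m) e,
    (N e (i.+1%:R * h) w - N e (i%:R * h) w)%N = (tnth v i == Some e) :> nat].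

Lemma patternE h m (v : m.-tuple _) : pattern h v =
  \bigcap_(e in [set` [set: edge n]%SET])
     increments_eq (fun i => i%:R * h) (fun i => (tnth v i == Some e) : nat) e.
Proof.
apply/seteqP; split => w /= H.
  by move=> e _ i _; exact: H.
by move=> i e; apply: (H e _ i) => /=; rewrite inE.
Qed.

(** Each clock contributes its Poisson factor exp(- h), and the one that rings a further h. *)
Definition step_weight (h : R) (o : option (edge n)) : R :=
  h ^+ isSome o * expR (- h) ^+ #|{: edge n}|.

Lemma prob_pattern h m (v : m.-tuple (option (edge n))) : 0 <= h ->
  P (pattern h v) = (\prod_(o <- v) step_weight h o)%:E.
Proof.
move=> h0; rewrite patternE (@prob_increments m _ (fun i e => tnth v i == Some e))//.
- congr (_%:E); rewrite big_tuple; apply: eq_bigr => i _.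
  have -> : i.+1%:R * h - i%:R * h = h by rewrite -natr1; ring.
  rewrite big_split/= prodr_const -expr_sum; congr (h ^+ _ * _).
  case: (tnth v i) => [e|/=]; last by rewrite big1.
  by rewrite (bigD1 e)//= eqxx big1// => e' /negPf ee'; rewrite (_ : (Some e == Some e') = (e == e'))// eq_sym ee'.
- by rewrite mul0r.
- by move=> i; rewrite ler_wpM2r// ler_nat.
Qed.

Lemma measurable_pattern h m (v : m.-tuple (option (edge n))) : measurable (pattern h v).
Proof.
rewrite patternE; apply: fin_bigcap_measurable; first exact: finite_finset.
move=> e _; apply: fin_bigcap_measurable; first exact: finite_finset.
move=> i _; set A := [set _]; rewrite [X in measurable X](_ : _ = \bigcup_x
    (((N e (i%:R * h) : T -> nat) @^-1` [set x]) `&`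
     ((N e (i.+1%:R * h) : T -> nat) @^-1` [set y | A (y - x)%N]))).
  by apply: bigcup_measurable => x _; apply: measurableI; exact: measurable_funPTI.
apply/seteqP; split => w /=; first by move=> H; exists (N e (i%:R * h) w).
by move=> [x _ [/= <-]].
Qed.

Lemma trivIset_pattern h m (D : set (m.-tuple (option (edge n)))) :
  trivIset D (@pattern h m).
Proof.
move=> v v' _ _ [w [/= Hv Hv']]; apply: eq_from_tnth => i.
have E e : (tnth v i == Some e) = (tnth v' i == Some e).
  by apply/(can_inj oddb); rewrite ?oddb -Hv Hv'.
case ov : (tnth v i) => [e|]; first by have := E e; rewrite ov eqxx => /esym/eqP ->.
by case ov' : (tnth v' i) => [e|//]; have := E e; rewrite ov ov' eqxx.
Qed.

Definition law (t : R) (s : 'S_n) : R := fine (P (pi t @^-1` [set s])).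

(** Patterns are disjoint, and outside a null set each of them determines the permutation at time m
    h. Only an inequality holds, since the patterns do not exhaust the paths. *)
Lemma pattern_le_law h m s : 0 <= h ->
  \sum_(v : m.-tuple (option (edge n)) | (\prod_(o <- v) step o)%g == s)
     \prod_(o <- v) step_weight h o <= law (m%:R * h) s.
Proof.
move=> h0; have mh0 : 0 <= m%:R * h by rewrite mulr_ge0.
have mpi := interchange_measurable ip s mh0.
have [N0 [mN0 PN0 sub]] : P.-negligible (~` [set w |
    [/\ pi 0 w = 1%g, (forall s t : R, 0 <= s -> s <= t ->
    (forall e u, s < u -> u <= t -> ~ rings (fun v => N e v w) u) ->
    pi t w = pi s w) & (forall (e : edge n) (t : R),
    rings (fun v => N e v w) t ->
    \forall u \near t^'-, pi t w = (pi u w * transposition e)%g)]]).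
  have := @filterS3 _ _ _ _ _ _ [set w |
    [/\ pi 0 w = 1%g, (forall s t : R, 0 <= s -> s <= t ->
    (forall e u, s < u -> u <= t -> ~ rings (fun v => N e v w) u) ->
    pi t w = pi s w) & (forall (e : edge n) (t : R),
    rings (fun v => N e v w) t ->
    \forall u \near t^'-, pi t w = (pi u w * transposition e)%g)]]
    _ (interchange_start ip) (interchange_constant ip) (interchange_jump ip).
  by apply => w; split.
rewrite -lee_fin fineK; last exact: fin_num_measure.
rewrite -sumEFin; under eq_bigr do rewrite -prob_pattern//.
pose D := [set v : m.-tuple (option (edge n)) | (\prod_(o <- v) step o)%g == s].
have -> : (\sum_(v : m.-tuple (option (edge n)) | (\prod_(o <- v) step o)%g == s)
   P (pattern h v) = P (\bigcup_(v in D) pattern h v))%E.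
  rewrite measure_fin_bigcup//; [|exact: finite_finset|exact: trivIset_pattern|by move=> v _; exact: measurable_pattern].
  apply: (bigfs _ (index_enum_uniq _)) => v _.
  by rewrite mem_index_enum.
apply: (@le_trans _ _ (P ((pi (m%:R * h) @^-1` [set s]) `|` N0))); last first.
  by apply: (le_trans (measureU2 _ mpi mN0)); rewrite [X in (_ + X <= _)%E](_ : _ = 0%E) ?adde0.
apply: le_measure; rewrite ?inE//.
- by apply: fin_bigcup_measurable => [|v _]; [exact: finite_finset | exact: measurable_pattern].
- exact: measurableU.
move=> w [v /eqP vs vw]; have [N0w|N0w] := pselect (N0 w); [by right|left].
have {N0w} /contrapT[p0 pc pj] := fun H => N0w (sub w H).
suff : pi ((size v)%:R * h) w = (pi 0 w * \prod_(o <- v) step o)%g.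
  by rewrite p0 mul1g vs size_tuple.
apply: (@path_steps _ _ (fun e x => N e x w) (fun x => pi x w) _ _ pc pj) => //.
- by move=> e a b a0 ab; apply: (poisson_nondecreasing (clocks_poisson ip e)).
- by move=> e a a0; apply: (poisson_right_continuous (clocks_poisson ip e)).
move=> i e; rewrite size_tuple => im.
have := vw (Ordinal im) e; rewrite (tnth_nth None)/= => <-.
rewrite addnC subnK//; apply: (poisson_nondecreasing (clocks_poisson ip e)).
  by rewrite mulr_ge0.
by rewrite ler_wpM2r// ler_nat.
Qed.


Lemma expectation_law (f : 'S_n -> R) (t : R) : 0 <= t -> (forall s, 0 <= f s) ->
  ('E_P[(fun w => f (pi t w))] = (\sum_s f s * law t s)%:E)%E.
Proof.
move=> t0 f0; rewrite unlock.
have mpi s := interchange_measurable ip s t0.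
transitivity (\int[P]_w (\sum_(s : 'S_n) (f s * \1_(pi t @^-1` [set s]) w)%:E))%E.
  apply: eq_integral => w _; rewrite sumEFin; congr (_%:E).
  rewrite (bigD1 (pi t w))//= indicE mem_set// mulr1 big1 ?addr0// => s sw.
  by rewrite indicE memNset ?mulr0// => /= /esym/eqP; rewrite (negPf sw).
rewrite ge0_integral_sum//.
- rewrite -sumEFin; apply: eq_bigr => s _.
  under eq_integral do rewrite EFinM.
  rewrite ge0_integralZl//.
  + rewrite integral_indic// setIT EFinM fineK//; exact: fin_num_measure.
  + by apply/measurable_EFinP; exact: measurable_indic.
  + by rewrite lee_fin.
- move=> s; apply/measurable_EFinP; exact: measurable_funM.
- by move=> s w _; rewrite lee_fin mulr_ge0.
Qed.

Lemma sum_law t : 0 <= t -> \sum_s law t s = 1.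
Proof.
move=> t0; have := expectation_law t0 (fun=> ler01).
rewrite (_ : (fun w => 1) = cst 1)// expectation_cst => -[->].
by apply: eq_bigr => s _; rewrite mul1r.
Qed.

End patterns.

(** * Sums over patterns and the limit of fine time grids *)

Lemma sum_tuple_cons (V : nmodType) (A : finType) m (F : m.+1.-tuple A -> V) :
  \sum_v F v = \sum_a \sum_(v : m.-tuple A) F [tuple of a :: v].
Proof.
rewrite pair_big/= (reindex (fun p : A * m.-tuple A => [tuple of p.1 :: p.2]))//=.
exists (fun v => (thead v, [tuple of behead v])) => [[a v] _|v _] /=.
  by rewrite theadE; congr pair; apply: val_inj.
by rewrite -tuple_eta.
Qed.

Lemma sum_option (V : nmodType) (A : finType) (F : option A -> V) :
  \sum_o F o = F None + \sum_a F (Some a).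
Proof.
rewrite (bigD1 None)//=; congr (_ + _).
rewrite (reindex_omap Some id)//=; last by case.
by apply: eq_bigl => a; rewrite eqxx.
Qed.

Lemma bernoulli_le (R : realDomainType) (z : R) m : 0 <= z -> z <= 1 ->
  1 - m%:R * z <= (1 - z) ^+ m.
Proof.
move=> z0 z1; elim: m => [|m IH]; first by rewrite mul0r subr0.
rewrite exprS; apply: (@le_trans _ _ ((1 - z) * (1 - m%:R * z))); last first.
  by rewrite ler_wpM2l// subr_ge0.
have : 0 <= m%:R * (z * z) by rewrite !mulr_ge0.
rewrite -natr1; nra.
Qed.

(** With y = x / m, the bound 1 - y <= exp(- y) gives exp(y) (1 - y^2) <= 1 + y; the m-th power of 1
    - y^2 is handled by Bernoulli's inequality. *)
Lemma expr1D_expR (R : realType) (x : R) m : (0 < m)%N -> `|x| <= m%:R ->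
  expR x * (1 - x ^+ 2 / m%:R) <= (1 + x / m%:R) ^+ m <= expR x.
Proof.
move=> m0; have mR : 0 < m%:R :> R by rewrite ltr0n.
set y := x / m%:R; have xy : x = m%:R * y by rewrite /y mulrC divfK// gt_eqF.
rewrite xy normrM (ger0_norm (ltW mR)) ger_pMr// => y1.
have := y1; rewrite ler_norml => /andP[ym yp].
have y0 : 0 <= 1 + y by lra.
have yy : y ^+ 2 <= 1 by rewrite -real_normK ?num_real// expr_le1.
rewrite expRM_natl; apply/andP; split; last by rewrite lerXn2r ?nnegrE ?expR_ge0// expR_ge1Dx.
apply: (@le_trans _ _ ((expR y * (1 - y ^+ 2)) ^+ m)); last first.
  rewrite lerXn2r ?nnegrE ?mulr_ge0 ?expR_ge0 ?subr_ge0//.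
  have -> : 1 - y ^+ 2 = (1 - y) * (1 + y) by ring.
  rewrite mulrA ler_piMl// -ler_pdivlMl ?expR_gt0// mulr1 -expRN.
  exact: expR_ge1Dx.
rewrite [leRHS]exprMn ler_wpM2l ?exprn_ge0 ?expR_ge0//.
apply: le_trans (bernoulli_le m (sqr_ge0 y) yy).
rewrite lerD2l lerN2 [leRHS](_ : _ = m%:R * y ^+ 2)//.
by field; rewrite gt_eqF.
Qed.

Lemma eq_of_dist_le_invn (R : realType) (a b B C : R) : 0 <= C ->
  (forall m, (0 < m)%N -> B <= m%:R -> `|a - b| <= C / m%:R) -> a = b.
Proof.
move=> C0 H; apply/eqP; rewrite -subr_eq0 -normr_le0; apply/negPn/negP.
rewrite -ltNge => ab0; set D := `|a - b| in H ab0.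
pose x := `|B| + C / D; have x0 : 0 <= x by rewrite addr_ge0// divr_ge0// ltW.
have := archi_boundP x0; set m := Num.bound x => xm.
have m0 : 0 < m%:R :> R by exact: le_lt_trans xm.
have Bm : B <= m%:R.
  by rewrite (le_trans (ler_norm B))// (le_trans _ (ltW xm))// lerDl divr_ge0// ltW.
have := H m; rewrite -(ltr0n R) m0 => /(_ isT Bm).
rewrite ler_pdivlMr// leNgt => /negP; apply.
rewrite mulrC -ltr_pdivrMr//; apply: le_lt_trans xm.
by rewrite lerDr.
Qed.

Section eigenfunctions.
Context (n : nat) (R : realType).
Let M : R := #|{: edge n}|%:R.
Variables (phi : 'S_n -> R) (lam : R).
Hypothesis phi_eigen : forall s,
  \sum_(e : edge n) phi (s * transposition e)%g = (M - lam) * phi s.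

Lemma sum_pattern_eigen h m s :
  \sum_(v : m.-tuple (option (edge n)))
     (\prod_(o <- v) step_weight h o) * phi (s * (\prod_(o <- v) step o)%g)%g =
  (expR (- h) ^+ #|{: edge n}| * (1 + h * (M - lam))) ^+ m * phi s.
Proof.
elim: m s => [|m IH] s.
  rewrite (big_pred1 [tuple]) ?big_nil ?mulg1// => v.
  by apply/esym/eqP/val_inj; case: v => -[].
rewrite sum_tuple_cons.
under eq_bigr => o _.
  under eq_bigr do rewrite !big_cons -mulrA mulgA.
  rewrite -mulr_sumr IH mulrCA; over.
rewrite -mulr_sumr sum_option/= mulg1 exprSr -mulrA; congr (_ * _).
rewrite /step_weight/=; under eq_bigr do rewrite expr1.
by rewrite -mulr_sumr phi_eigen expr0; ring.
Qed.

End eigenfunctions.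

(** The interval [0, t] is cut into m pieces. The patterns form a subprobability [r] below the law,
    whose missing mass is O(1/m) and against which phi is computed exactly; then m is arbitrarily
    large. *)
Lemma law_eigen n d (T : measurableType d) (R : realType) (P : probability T R)
    (N : edge n -> R -> {RV P >-> nat}) (pi : R -> T -> 'S_n) (phi : 'S_n -> R) (lam t : R) :
  interchange_process N pi -> 0 <= t ->
  (forall s, \sum_(e : edge n) phi (s * transposition e)%g =
     (#|{: edge n}|%:R - lam) * phi s) ->
  \sum_s phi s * law P pi t s = expR (- (lam * t)) * phi 1%g.
Proof.
move=> ip t0 eig; set M : R := #|{: edge n}|%:R in eig.
pose K := \sum_s `|phi s|.
have K0 : 0 <= K by apply: sumr_ge0.
pose x := t * (M - lam).
(* The threshold on m serves the hypothesis of [expr1D_expR]. The constant adds the cost of the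
   missing mass and the error of the discrete exponential. *)
apply: (@eq_of_dist_le_invn _ _ _ (`|x| + `|t * M|)
  (K * (t * M) ^+ 2 + expR (- (lam * t)) * x ^+ 2 * `|phi 1%g|)).
  apply: addr_ge0; apply: mulr_ge0 => //; first exact: sqr_ge0.
  by apply: mulr_ge0; [exact: expR_ge0 | exact: sqr_ge0].
move=> m m0 Bm; have mR : 0 < m%:R :> R by rewrite ltr0n.
have [xm tMm] : `|x| <= m%:R /\ `|t * M| <= m%:R.
  by split; apply: le_trans Bm; rewrite ?lerDl ?lerDr.
pose h := t / m%:R; have h0 : 0 <= h by rewrite divr_ge0// ltW.
have mh : m%:R * h = t by rewrite /h mulrC divfK// gt_eqF.
pose r s := \sum_(v : m.-tuple (option (edge n)) | (\prod_(o <- v) step o)%g == s)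
     \prod_(o <- v) step_weight h o.
have r_le s : r s <= law P pi t s.
  by rewrite -mh; apply: (pattern_le_law ip).
have sum_r (f : 'S_n -> R) lam' : (forall s, \sum_(e : edge n) f (s * transposition e)%g =
     (M - lam') * f s) ->
    \sum_s f s * r s = expR (- (t * M)) * (1 + t * (M - lam') / m%:R) ^+ m * f 1%g.
  move=> feig; transitivity (\sum_(v : m.-tuple (option (edge n)))
     (\prod_(o <- v) step_weight h o) * f (1%g * (\prod_(o <- v) step o)%g)%g).
    rewrite [RHS](partition_big (fun v : m.-tuple _ => (\prod_(o <- v) step o)%g) xpredT)//=.
    apply: eq_bigr => s _; rewrite mulr_sumr; apply: eq_bigr => v /eqP <-.
    by rewrite mul1g mulrC.
  rewrite (sum_pattern_eigen feig) exprMn -exprM mulnC exprM -expRM_natl.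
  rewrite mulrN mh -expRM_natr mulNr; congr (_ * _ ^+ _ * _).
  by rewrite /h mulrAC.
(* The constant function 1 is an eigenfunction with [lam] = 0, so [sum_r] also gives the total
   mass. *)
have sum1r : 1 - \sum_s r s <= (t * M) ^+ 2 / m%:R.
  have -> : \sum_s r s = expR (- (t * M)) * (1 + t * M / m%:R) ^+ m.
    have := sum_r (fun=> 1) 0; rewrite subr0 !mulr1 => <-.
      by apply: eq_bigr => s _; rewrite mul1r.
    by move=> s; rewrite sumr_const.
  have /andP[H _] := expr1D_expR m0 tMm.
  rewrite lerBlDr -lerBlDl.
  have := expRxMexpNx_1 (t * M) => E.
  apply: (@le_trans _ _ (expR (- (t * M)) * (expR (t * M) * (1 - (t * M) ^+ 2 / m%:R)))).
    by rewrite mulrA (mulrC (expR _)) E mul1r.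
  by rewrite ler_wpM2l ?expR_ge0.
have := sum_r phi lam eig; rewrite -/x => sphi.
have -> : \sum_s phi s * law P pi t s - expR (- (lam * t)) * phi 1%g =
    \sum_s phi s * (law P pi t s - r s) +
    (\sum_s phi s * r s - expR (- (lam * t)) * phi 1%g).
  rewrite addrA; congr (_ - _); rewrite -big_split/=; apply: eq_bigr => s _.
  by rewrite -mulrDr subrK.
apply: (le_trans (ler_normD _ _)); rewrite [leRHS]mulrDl; apply: lerD.
  apply: (le_trans (ler_norm_sum _ _ _)).
  apply: (@le_trans _ _ (\sum_s K * (law P pi t s - r s))).
    apply: ler_sum => s _; rewrite normrM (@ger0_norm _ (_ - _)) ?subr_ge0//.
    by rewrite ler_wpM2r ?subr_ge0// /K (bigD1 s)//= lerDl sumr_ge0.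
  by rewrite -mulr_sumr sumrB (sum_law ip t0) -mulrA ler_wpM2l.
rewrite sphi -mulrBl normrM -[leRHS]mulrA [`|phi _| / _]mulrC mulrA ler_wpM2r//.
have /andP[lo hi] := expr1D_expR m0 xm.
have E : expR (- (t * M)) * expR x = expR (- (lam * t)).
  by rewrite -expRD /x; congr expR; ring.
rewrite ler_norml; apply/andP; split.
  rewrite lerBrDl [leLHS](_ : _ = expR (- (t * M)) * (expR x * (1 - x ^+ 2 / m%:R))).
    by rewrite ler_wpM2l ?expR_ge0.
  by rewrite mulrA E; ring.
apply: (@le_trans _ _ 0); last first.
  by apply: divr_ge0 => //; apply: mulr_ge0; [exact: expR_ge0 | exact: sqr_ge0].
by rewrite subr_le0 -E ler_wpM2l ?expR_ge0.
Qed.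

(** * The magnetisation *)

(** The right side has one more term, whose last difference is - b n: thus the sum over k <= n
    becomes a sum over the values of n + 1 spins. *)
Lemma abel_summation (R : comPzRingType) (a b : nat -> R) n : b n.+1 = 0 ->
  \sum_(k < n.+1) (a k.+1 - a k) * b k =
  - \sum_(k < n.+2) a k * (b k - (if (k : nat) is k'.+1 then b k' else 0)).
Proof.
move=> bn; rewrite [in RHS]big_ord_recr/= bn sub0r mulrN.
suff -> m : \sum_(k < m.+1) (a k.+1 - a k) * b k = a m.+1 * b m -
    \sum_(k < m.+1) a k * (b k - (if (k : nat) is k'.+1 then b k' else 0)).
  by rewrite opprB.
elim: m => [|m IH]; first by rewrite !big_ord1/= subr0 mulrBl.
by rewrite big_ord_recr IH [in RHS]big_ord_recr/=; ring.
Qed.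

(** * From characters to Curie-Weiss sums *)

Section magnetisation_formula.
Context (n : nat) d (T : measurableType d) (R : realType) (P : probability T R).
Context (N : edge n -> R -> {RV P >-> nat}) (pi : R -> T -> 'S_n).
Hypothesis ip : interchange_process N pi.
Variable t : R.
Hypothesis t0 : 0 <= t.

Let scale : R := expR (- (t * n.+1%:R ^+ 2 / 4)) / n.+1%:R.

(** With N = n + 1, the identity k (N - k) = (N^2 - (N - 2 k)^2) / 4 turns the decay exp(- k (N - k)
    t) into the Curie-Weiss weight at N - 2 k. *)
Lemma mean_two_row_character k : (k <= n.+1)%N ->
  \sum_s two_row_character R k s * law P pi t s =
  scale * ('C(n.+1, k)%:R * ((n.+1%:R - k.*2%:R) * curie_weiss t (n.+1%:R - k.*2%:R))).
Proof.
move=> kn; have n0 : n.+1%:R != 0 :> R by rewrite pnatr_eq0.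
rewrite (law_eigen ip t0 (fun s => sum_edge_two_row_character R s kn)).
apply: (mulfI n0); rewrite mulrCA two_row_character1//.
have -> : expR (- (k%:R * (n.+1%:R - k%:R) * t)) =
    expR (- (t * n.+1%:R ^+ 2 / 4)) * curie_weiss t (n.+1%:R - k.*2%:R) :> R.
  by rewrite -expRD -mul2n natrM; congr expR; field.
by rewrite /scale; field; rewrite addrC natr1.
Qed.

(** a is a discrete primitive of b, written as a function of the spin value; summation by parts then
    turns the f_k into the characters. *)
Lemma mean_invariant_sets (a b : nat -> R) (c : R -> R) :
  (forall k, a k.+1 - a k = b k) -> (forall k, a k = - c (n.+1%:R - k.*2%:R)) ->
  \sum_s (\sum_(k < n.+1) b k * (invariant_sets k s)%:R) * law P pi t s =
  scale * spin_sum n.+1 (fun x => c x * x * curie_weiss t x).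
Proof.
move=> ab ac; pose mu k := \sum_s (invariant_sets k s)%:R * law P pi t s.
transitivity (\sum_(k < n.+1) (a k.+1 - a k) * mu k).
  under eq_bigr do rewrite mulr_suml.
  rewrite exchange_big; apply: eq_bigr => k _; rewrite ab mulr_sumr.
  by apply: eq_bigr => s _; rewrite mulrA.
rewrite abel_summation; last by rewrite /mu big1// => s _; rewrite invariant_sets_gt// mul0r.
rewrite /spin_sum mulr_sumr -sumrN; apply: eq_bigr => k _.
have -> : mu k - (if (k : nat) is k'.+1 then mu k' else 0) =
    \sum_s two_row_character R k s * law P pi t s.
  rewrite /two_row_character; under eq_bigr do rewrite mulrBl.
  rewrite sumrB; congr (_ - _); case: (nat_of_ord k) => [|k']//.
  by rewrite big1// => s _; rewrite mul0r.
rewrite mean_two_row_character -1?ltnS// ac; ring.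
Qed.

Lemma partition_functionE : partition_function P pi t =
  scale / 2 * spin_sum n.+1 (fun x => x ^+ 2 * curie_weiss t x).
Proof.
rewrite /partition_function (expectation_law ip (f := fun s => 2 ^+ num_cycles s))//=.
transitivity (\sum_s (\sum_(k < n.+1) 1 * (invariant_sets k s)%:R) * law P pi t s).
  apply: eq_bigr => s _; rewrite (sum_invariant_sets (fun=> 1)) sumr_const.
  by rewrite card_invariant natrX.
rewrite (@mean_invariant_sets (fun k => - ((n.+1%:R - k.*2%:R) / 2)) (fun=> 1) (fun x => x / 2))//.
  rewrite -[RHS]mulrA; congr (_ * _); rewrite -spin_sumZ; apply: eq_spin_sum => x.
  by field.
by move=> k; rewrite -!mul2n !natrM -natr1; field.
Qed.

Let cycle_moment (s : 'S_n) : R :=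
  (\sum_(1 <= k < n.+1) k ^ 2 * cycles_of_length k s)%N%:R * 2 ^+ num_cycles s.

Let cycle_moment_ge0 s : 0 <= cycle_moment s.
Proof. by rewrite mulr_ge0// exprn_ge0. Qed.

Let A := spin_sum n.+1 (fun x => x ^+ 4 * curie_weiss t x).
Let S := spin_sum n.+1 (fun x => x ^+ 2 * curie_weiss t x).

Lemma magnetisation_numeratorE :
  fine 'E_P[(fun w =>
      (\sum_(1 <= k < n.+1) k ^ 2 * cycles_of_length k (pi t w))%N%:R
      * 2 ^+ num_cycles (pi t w))%R]%E =
  scale / 6 * (A - S).
Proof.
rewrite (expectation_law ip t0 cycle_moment_ge0)/=.
transitivity (\sum_s (\sum_(k < n.+1) (n%:R - k.*2%:R) ^+ 2 * (invariant_sets k s)%:R) * law P pi t s).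
  apply: eq_bigr => s _.
  rewrite (sum_invariant_sets (fun k => (n%:R - k.*2%:R) ^+ 2)) sum_invariant_sqr.
  by rewrite /cycle_moment natrM natrX.
(* For x = n + 1 - 2 k and c x = (x^3 - x) / 6 one has c x - c (x - 2) = (x - 1)^2 = (n - 2 k)^2. *)
rewrite (@mean_invariant_sets (fun k => - (((n.+1%:R - k.*2%:R) ^+ 3 - (n.+1%:R - k.*2%:R)) / 6))
  (fun k => (n%:R - k.*2%:R) ^+ 2) (fun x => (x ^+ 3 - x) / 6))//.
  rewrite -[RHS]mulrA; congr (_ * _); rewrite -spin_sumB -spin_sumZ; apply: eq_spin_sum => x.
  by field.
by move=> k; rewrite -!mul2n !natrM -!natr1; field.
Qed.

Lemma spin_sum_curie_weiss_gt0 : 0 < S.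
Proof.
apply: (@lt_le_trans _ _ (spin_sum n.+1 (fun x => x ^+ 2))).
  by rewrite spin_sum_sqr mulr_gt0// exprn_gt0.
apply: ler_spin_sum => x _; rewrite ler_peMr ?sqr_ge0//.
by rewrite -expR0 ler_expR divr_ge0// mulr_ge0// sqr_ge0.
Qed.

Lemma magnetisationE : magnetisation P pi t = Num.sqrt ((A / S - 1) / 3).
Proof.
have S0 := spin_sum_curie_weiss_gt0.
rewrite /magnetisation magnetisation_numeratorE partition_functionE -/S; congr Num.sqrt.
have sc : scale != 0.
  by rewrite mulf_neq0 ?invr_neq0 ?pnatr_eq0// gt_eqF// expR_gt0.
by field; rewrite (gt_eqF S0) sc.
Qed.

(** A permutation of a nonempty set has a cycle, so sum_k k^2 alpha_k >= 1 pointwise and the squared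
    magnetisation is at least 1. *)
Lemma spin_ratio_ge : (0 < n)%N -> 1 <= (A / S - 1) / 3.
Proof.
move=> n0; have S0 := spin_sum_curie_weiss_gt0.
have sc0 : 0 < scale by rewrite divr_gt0// expR_gt0.
have : partition_function P pi t <= scale / 6 * (A - S).
  rewrite -magnetisation_numeratorE /partition_function.
  rewrite (expectation_law ip t0 cycle_moment_ge0).
  rewrite (expectation_law ip (f := fun s => 2 ^+ num_cycles s))//=.
  apply: ler_sum => s _; rewrite ler_wpM2r ?fine_ge0// ler_peMl ?exprn_ge0// ler1n.
  rewrite (sum_cycles_of_length (fun k => k ^ 2)%N).
  pose i := Ordinal n0; rewrite (bigD1 (porbit s i)) ?imset_f//= addn_gt0 expn_gt0.
  by rewrite (_ : (0 < _)%N)//; apply/card_gt0P; exists i; exact: porbit_id.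
rewrite partition_functionE -/S; move: sc0; generalize scale => c c0.
rewrite -![c / _ * _]mulrA ler_pM2l// => H.
by rewrite ler_pdivlMr// lerBrDr ler_pdivlMr//; move: H; lra.
Qed.

Lemma spin_ratio_le : A / S <= n.+1%:R ^+ 2.
Proof.
have S0 := spin_sum_curie_weiss_gt0.
rewrite ler_pdivrMr// -spin_sumZ; apply: ler_spin_sum => x xn.
rewrite mulrA ler_wpM2r ?expR_ge0// (exprD x 2 2) ler_wpM2r ?sqr_ge0//.
by rewrite -real_normK ?num_real// ler_sqr ?nnegrE.
Qed.

End magnetisation_formula.

(** * The subcritical and supercritical regimes *)

Theorem theorem1 (R : realType) :
  (forall tau : R, 0 <= tau -> tau < 2 ->
     exists C : R, 0 < C /\
       forall (n : nat), (1 <= n)%N ->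
       forall (d : measure_display) (T : measurableType d)
         (P : probability T R)
         (N : edge n -> R -> {RV P >-> nat}) (pi : R -> T -> 'S_n),
         interchange_process N pi ->
         magnetisation P pi (tau / n%:R) <= C * Num.sqrt n%:R) /\
  (forall tau : R, 2 < tau ->
     exists c : R, 0 < c /\
       forall (n : nat), (1 <= n)%N ->
       forall (d : measure_display) (T : measurableType d)
         (P : probability T R)
         (N : edge n -> R -> {RV P >-> nat}) (pi : R -> T -> 'S_n),
         interchange_process N pi ->
         c * n%:R <= magnetisation P pi (tau / n%:R)).
Proof.
split=> tau => [tau0 tau2|tau2].
  (* For n >= B one has (n + 1) tau / (2 n) <= 1 - (2 - tau) / 4, and the high-temperature bound
     gives the first term of K. For n < B the trivial bound m_n^2 <= n^2 <= B n suffices. *)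
  pose B := 2 * tau / (2 - tau); pose K := 8 * expR 1 / (2 - tau) + B.
  have d0 : 0 < 2 - tau by lra.
  have B0 : 0 <= B by rewrite divr_ge0 ?mulr_ge0// ltW.
  have K1 : 0 < 8 * expR 1 / (2 - tau) by rewrite divr_gt0// mulr_gt0// expR_gt0.
  have K0 : 0 < K by rewrite ltr_pwDl.
  exists (Num.sqrt K); split; first by rewrite sqrtr_gt0.
  move=> n n0 d T P N pi ip.
  have nR : 1 <= n%:R :> R by rewrite ler1n.
  have nR0 : 0 < n%:R :> R by lra.
  have t0 : 0 <= tau / n%:R by rewrite divr_ge0.
  rewrite (magnetisationE ip t0) -sqrtrM ?(ltW K0)// ler_wsqrtr//.
  have S0 := spin_sum_curie_weiss_gt0 n t0.
  have [nB|nB] := ltP n%:R B.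
    have := spin_ratio_le n t0; set q := _ / _ => qN.
    apply: (@le_trans _ _ (n%:R * n%:R)); first by move: qN; rewrite -natr1; nra.
    by rewrite ler_wpM2r ?(ltW nR0)// (le_trans (ltW nB))// lerDr ltW.
  have Nt : n.+1%:R * (tau / n%:R) / 2 <= 1 - (2 - tau) / 4.
    have -> : n.+1%:R * (tau / n%:R) / 2 = tau / 2 + tau / 2 / n%:R.
      by rewrite -natr1; field; rewrite gt_eqF.
    have : tau / 2 / n%:R <= (2 - tau) / 4.
      have nB' : 2 * tau <= n%:R * (2 - tau) by rewrite -ler_pdivrMr.
      by rewrite ler_pdivrMr//; lra.
    lra.
  have := @curie_weiss_high_temperature R n.+1 _ t0.
  set x := n.+1%:R * _ in Nt *.
  have x2 : x < 2 by lra.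
  move=> /(_ x2); set A := spin_sum _ _; set S := spin_sum _ _ in S0 * => H.
  have H1 : (2 - tau) / 4 * A <= 3 * n.+1%:R * expR 1 * S.
    have A0 : 0 <= A.
      apply: sumr_ge0 => i _; rewrite mulr_ge0// mulr_ge0 ?expR_ge0//.
      by rewrite exprn_even_ge0.
    apply: (@le_trans _ _ ((1 - x / 2) * A)); first by rewrite ler_wpM2r//; lra.
    apply: (le_trans H); rewrite ler_wpM2r ?(ltW S0)// ler_wpM2l ?mulr_ge0//.
    by rewrite ler_expR; lra.
  apply: (@le_trans _ _ (8 * expR 1 / (2 - tau) * n%:R)); last first.
    by rewrite ler_wpM2r ?(ltW nR0)// /K lerDl.
  have H2 : A / S <= 12 * n.+1%:R * expR 1 / (2 - tau).
    rewrite ler_pdivrMr// [leRHS](_ : _ = 3 * n.+1%:R * expR 1 * S / ((2 - tau) / 4)).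
      by rewrite ler_pdivlMr ?divr_gt0// mulrC.
    by field; rewrite gt_eqF.
  have H3 : n.+1%:R * (expR 1 / (2 - tau)) <= 2 * n%:R * (expR 1 / (2 - tau)).
    rewrite ler_wpM2r ?divr_ge0 ?expR_ge0 ?(ltW d0)//.
    by rewrite -natr1; lra.
  rewrite [leRHS](_ : _ = 4 * (2 * n%:R * (expR 1 / (2 - tau)))); last by field; rewrite gt_eqF.
  rewrite (_ : _ / (2 - tau) = 12 * (n.+1%:R * (expR 1 / (2 - tau)))) in H2; last by rewrite !mulrA.
  lra.
(* The tilt h must satisfy ln(cosh h) > h^2 / tau. As cosh h >= 1 + z / 2 for h^2 = z, this choice
   works because (1 + z / 2) (1 - z / tau) > 1. *)
pose z := (tau - 2) / 2; pose h := Num.sqrt z.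
have z0 : 0 < z by rewrite divr_gt0// subr_gt0.
have hz : h ^+ 2 = z by rewrite sqr_sqrtr// ltW.
have tau0 : 0 < tau by lra.
(* The exponential rate in n of the lower bound cosh(h)^n exp(- h^2 / t) at t = tau / n. *)
pose kappa := ln (cosh h) - z / tau.
have kappa0 : 0 < kappa.
  rewrite subr_gt0 -ltr_expR lnK ?posrE ?cosh_gt0//.
  apply: lt_le_trans (cosh_ge h); rewrite hz.
  have zt : 0 < 1 - z / tau by rewrite subr_gt0 ltr_pdivrMr// /z; lra.
  apply: (@le_lt_trans _ _ (1 - z / tau)^-1).
    by rewrite -[leLHS]invrK lef_pV2 ?posrE ?invr_gt0 ?expR_gt0// -expRN expR_ge1Dx.
  rewrite -(ltr_pM2r zt) mulVf ?gt_eqF//.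
  have -> : (1 + z / 2) * (1 - z / tau) = 1 + z * z / (2 * tau).
    have -> : tau = 2 * z + 2 by rewrite /z; field.
    by field; apply/eqP; lra.
  by rewrite ltrDl; apply: divr_gt0; apply: mulr_gt0.
exists (Num.sqrt (kappa / tau)); split; first by rewrite sqrtr_gt0 divr_gt0.
move=> n n0 d T P N pi ip.
have nR : 0 < n%:R :> R by rewrite ltr0n.
have t0 : 0 < tau / n%:R by rewrite divr_gt0.
have nE : n%:R = Num.sqrt (n%:R ^+ 2) :> R by rewrite sqrtr_sqr ger0_norm// ltW.
rewrite (magnetisationE ip (ltW t0)) [X in _ * X <= _]nE.
rewrite -sqrtrM ?divr_ge0 ?(ltW kappa0) ?(ltW tau0)// ler_wsqrtr//.
(* It means q >= 4, so (q - 1) / 3 >= q / 4; this absorbs the - 1 at the end. *)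
have q1 := spin_ratio_ge ip (ltW t0) n0.
have [_] := curie_weiss_tilt h t0 (ltn0Sn n).
set q := spin_sum _ _ / spin_sum _ _ in q1 *; rewrite hz => H.
have : n%:R * kappa <= tau / n%:R * q / 4.
  rewrite -ler_expR; apply: le_trans H; rewrite /kappa mulrBr expRD.
  have -> : n%:R * (z / tau) = z / (tau / n%:R) by field; rewrite !gt_eqF.
  rewrite ler_wpM2r ?expR_ge0// expRM_natl lnK ?posrE ?cosh_gt0//.
  (* There are n + 1 spins but only n factors are wanted; cosh h >= 1 allows one to be dropped. *)
  by rewrite ler_weXn2l// cosh_ge1.
have -> : tau / n%:R * q / 4 = (tau * q) / (4 * n%:R) by field; rewrite gt_eqF.
rewrite ler_pdivlMr ?mulr_gt0// mulrC => H1.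
have H2 : 4 * (kappa / tau * n%:R ^+ 2) <= q.
  rewrite -(ler_pM2l tau0); apply: le_trans H1.
  by rewrite le_eqVlt; apply/orP; left; apply/eqP; field; rewrite gt_eqF.
lra.
Qed.
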